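(* For a configuration $\mathbf x=(\vec x,\vec\alpha)$ with a finite number $N$ of particles at sites $x_1<\dots<x_N$ and of species $\alpha_1,\dots,\alpha_N\in\{1,\dots,n\}$ put $$D^+(\mathbf x,\eta)=\prod_{i=1}^N q^{-2\sum_{l<x_i}(1-m^{\alpha_i}_l(\eta))}\,m^{\alpha_i}_{x_i}(\eta),\qquad D^-(\mathbf x,\eta)=\prod_{i=1}^N q^{2\sum_{l>x_i}(1-m^{\alpha_i}_l(\eta))}\,m^{\alpha_i}_{x_i}(\eta),$$ the sums running over sites $l$ of the lattice under consideration. (a) The $n$-priority ASEP on $\Lambda_+=\{k\in\mathbb Z:k\ge L^-\}$ is self-dual with respect to $D^+(\mathbf x,\eta)$ for all $\eta\in\{0,\dots,n\}^{\Lambda_+}$, and the $n$-priority ASEP on $\Lambda_-=\{k\in\mathbb Z:k\le L^+\}$ is self-dual with respect to $D^-(\mathbf x,\eta)$ for all $\eta\in\{0,\dots,n\}^{\Lambda_-}$. (b) The $n$-priority ASEP on $\mathbb Z$ is self-dual with respect to $D^+(\mathbf x,\eta)$ for all $\eta\in\mathbb S^{\mathbb Z}_{n^<}$, and with respect to $D^-(\mathbf x,\eta)$ for all $\eta\in\mathbb S^{\mathbb Z}_{n^>}$.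
   Context: Fix an integer $n\ge1$, reals $w>0$, $q\ge1$, and integers $L^\pm$. For a lattice $\Lambda\in\{\Lambda_+,\Lambda_-,\mathbb Z\}$ the $n$-priority ASEP on $\Lambda$ is the Markov process on $\{0,\dots,n\}^\Lambda$ with generator (on cylinder functions) $$\mathcal Lf(\eta)=\sum_{k:\,k,k+1\in\Lambda}w\big(q^{\operatorname{sgn}(\eta_k-\eta_{k+1})}-\delta_{\eta_k,\eta_{k+1}}\big)\,[f(\eta^{kk+1})-f(\eta)],$$ where $\eta^{kk+1}$ is $\eta$ with the values at $k$ and $k+1$ interchanged and $\operatorname{sgn}(0)=0$. For $\eta\in\{0,\dots,n\}^\Lambda$ and $0\le\alpha\le n$, $m^\alpha_k(\eta)=1$ if $\eta_k\ge\alpha$ and $0$ otherwise. The sets of right- and left-asymptotically fully occupied configurations are $$\mathbb S^{\mathbb Z}_{n^>}=\Big\{\eta\in\{0,\dots,n\}^{\mathbb Z}:\sum_{k\ge1}(1-\delta_{\eta_k,n})<\infty\Big\},\qquad \mathbb S^{\mathbb Z}_{n^<}=\Big\{\eta\in\{0,\dots,n\}^{\mathbb Z}:\sum_{k\le0}(1-\delta_{\eta_k,n})<\infty\Big\}.$$ A configuration $\mathbf x$ with finitely many particles is identified with the occupation configuration having $\eta_{x_i}=\alpha_i$ and $\eta_k=0$ at all other sites; $P(\mathbf y,t|\mathbf x,0)$ denotes the transition probability of the $n$-priority ASEP on the same lattice from $\mathbf x$ to $\mathbf y$ in time $t$. Self-dual with respect to $D$ for all $\eta$ in a set means that for every such $\mathbf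 x$, every $\eta$ in that set and every $t\ge0$, $$\mathbf E^\eta D(\mathbf x,\eta_t)=\sum_{\mathbf y}D(\mathbf y,\eta)\,P(\mathbf y,t|\mathbf x,0).$$ *)

(* Defs.v *)
From HB Require Import structures.
From mathcomp Require Import all_boot all_order all_algebra.
From mathcomp Require Import all_classical all_reals all_analysis.
From mathcomp Require Import measurable_realfun.
Import Order.TTheory GRing.Theory Num.Theory.
Import numFieldNormedType.Exports.

Set Implicit Arguments.
Unset Strict Implicit.
Unset Printing Implicit Defensive.

Local Open Scope classical_set_scope.
Local Open Scope ring_scope.

Definition right_half_line (L : int) : pred int := fun k => L <= k.
Definition left_half_line (L : int) : pred int := fun k => k <= L.
Definition full_line : pred int := fun=> true.

Definition site (Lam : pred int) := {k : int | Lam k}.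

(* The configuration space {0,..,n}^Lam is compact: it carries the product of
   the discrete topologies, and its Borel sigma-algebra. *)
Definition config (n : nat) (Lam : pred int) := site Lam -> 'I_n.+1.

HB.instance Definition _ (n : nat) (Lam : pred int) :=
  Choice.on (config n Lam).
HB.instance Definition _ (n : nat) (Lam : pred int) :=
  isPointed.Build (config n Lam) (fun=> ord0).
HB.instance Definition _ (n : nat) (Lam : pred int) :=
  Topological.copy (config n Lam)
    (prod_topology (fun _ : site Lam => discrete_topology 'I_n.+1)).
HB.instance Definition _ (n : nat) (Lam : pred int) :=
  Measurable.copy (config n Lam) (g_sigma_algebraType (@open (config n Lam))).

Section Generator.
Context {R : realType} (n : nat) (w q : R) (Lam : pred int).
Implicit Types (eta : config n Lam) (f : config n Lam -> R).

Definition exchange eta (k l : site Lam) : config n Lam :=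
  fun j => if j == k then eta l else if j == l then eta k else eta j.

Definition is_cylinder f :=
  exists2 A : set (site Lam), finite_set A &
    forall eta zeta, (forall k, A k -> eta k = zeta k) -> f eta = f zeta.

Definition bonds : set (site Lam * site Lam) :=
  [set b | val b.2 = val b.1 + 1].

Definition rate eta (k l : site Lam) : R :=
  w * (q ^ sgz ((eta k)%:Z - (eta l)%:Z) - (eta k == eta l)%:R).

(* The sum over bonds is a finitely supported one (it would be 0 by convention
   on an infinite support, which does not occur for cylinder functions). *)
Definition generator f eta : R :=
  \sum_(b \in bonds) rate eta b.1 b.2 * (f (exchange eta b.1 b.2) - f eta).

End Generator.

Section MarkovProcess.
Context {R : realType} (n : nat) (Lam : pred int).
Context (d : measure_display) (Omega : measurableType d).
(* [P eta] is the law of the process started from [eta];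
   [X t] is the configuration at time [t], for [0 <= t]. *)
Variables (P : config n Lam -> probability Omega R).
Variables (X : R -> Omega -> config n Lam).

Definition history (s : R) : set (set Omega) :=
  <<s \bigcup_(r in [set r : R | 0 <= r <= s])
        preimage_set_system setT (X r) measurable >>.

Definition is_markov :=
  [/\ forall t : R, 0 <= t -> measurable_fun setT (X t),
      forall eta, P eta [set omega | X 0 omega = eta] = 1%E,
      forall (t : R) (B : set (config n Lam)), 0 <= t -> measurable B ->
        measurable_fun setT (fun eta => P eta (X t @^-1` B)) &
      forall eta (s t : R) (A : set Omega) (B : set (config n Lam)),
        0 <= s -> 0 <= t -> history s A -> measurable B ->
        P eta (A `&` X (s + t) @^-1` B) =
        (\int[P eta]_(omega in A) P (X s omega) (X t @^-1` B))%E].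

Definition semigroup (t : R) (f : config n Lam -> R) : config n Lam -> R :=
  fun eta => \int[P eta]_(omega in setT) f (X t omega).

Definition is_feller :=
  forall f : config n Lam -> R, continuous f ->
    (forall t : R, 0 <= t -> continuous (semigroup t f)) /\
    {uniform, (fun t => semigroup t f) @ 0^'+ --> f}.

(* The Markov process on Lam whose generator acts on cylinder functions as
   [generator w q]. By Liggett's theorem the cylinder functions form a core, so that these
   properties determine the law of the process. *)
Definition is_priority_asep (w q : R) :=
  [/\ is_markov, is_feller &
      forall f : config n Lam -> R, is_cylinder f ->
        {uniform, (fun t eta => (semigroup t f eta - f eta) / t) @ 0^'+
                  --> generator w q f}].

End MarkovProcess.

(* Finitely many particles (x_i, alpha_i), listed with x_1 < ... < x_N, of
   species alpha_i in {1,..,n}. *)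
Definition particles (n : nat) (Lam : pred int) :=
  {s : seq (site Lam * 'I_n.+1) |
    sorted (fun u v => val u.1 < val v.1) s && all (fun u => u.2 != ord0) s}.

(* Sites outside the list have index [size], hence get the default value 0. *)
Definition occupation (n : nat) (Lam : pred int) (x : particles n Lam) :
    config n Lam :=
  fun k => nth ord0 (unzip2 (val x)) (index k (unzip1 (val x))).

Section Duality.
Context {R : realType} (n : nat) (Lam : pred int).
Implicit Types (eta : config n Lam) (x y : particles n Lam).

Definition m (alpha : 'I_n.+1) (k : site Lam) eta : R := (alpha <= eta k)%:R.

(* q ^ s for 1 <= q and an extended real exponent s; in particular
   q ^ +oo = +oo and q ^ -oo = 0 if 1 < q, and 1 ^ s = 1. *)
Definition qpow (q : R) (s : \bar R) : \bar R := expeR ((ln q)%:E * s)%E.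

(* Number of sites l in A with eta_l < alpha. *)
Definition deficit (alpha : 'I_n.+1) (A : set (site Lam)) eta : \bar R :=
  \esum_(l in A) (1 - m alpha l eta)%:E.

(* Extended real valued, so as to be defined on all configurations even though
   the sums over the sites l may diverge. *)
Definition D_plus (q : R) x eta : \bar R :=
  (\prod_(u <- val x)
     (qpow q ((- 2%R)%:E * deficit u.2 [set l | (val l < val u.1)%R] eta)
      * (m u.2 u.1 eta)%:E))%E.

Definition D_minus (q : R) x eta : \bar R :=
  (\prod_(u <- val x)
     (qpow q ((2%R)%:E * deficit u.2 [set l | (val u.1 < val l)%R] eta)
      * (m u.2 u.1 eta)%:E))%E.

(* Integrability says that the expectation in the duality relation is a
   (finite) real number. *)
Definition self_dual (d : measure_display) (Omega : measurableType d)
    (P : config n Lam -> probability Omega R)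
    (X : R -> Omega -> config n Lam)
    (D : particles n Lam -> config n Lam -> \bar R)
    (S : set (config n Lam)) :=
  forall x eta (t : R), S eta -> 0 <= t ->
    (P eta).-integrable setT (fun omega => D x (X t omega)) /\
    (\int[P eta]_(omega in setT) D x (X t omega) =
     \esum_(y in [set: particles n Lam])
        (D y eta * P (occupation x) [set omega | X t omega = occupation y]))%E.

End Duality.

Definition right_full (R : realType) (n : nat) : set (config n full_line) :=
  [set eta | (\esum_(k in [set k : site full_line | (1 <= val k)%R])
                ((1 - (eta k == ord_max)%:R)%R : R)%:E < +oo)%E].

Definition left_full (R : realType) (n : nat) : set (config n full_line) :=
  [set eta | (\esum_(k in [set k : site full_line | (val k <= 0)%R])
                ((1 - (eta k == ord_max)%:R)%R : R)%:E < +oo)%E].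

Arguments right_full R n : clear implicits.
Arguments left_full R n : clear implicits.

(* Main.v *)
Require Import Defs.
From mathcomp Require Import all_boot all_order all_algebra.
From mathcomp Require Import all_classical all_reals all_analysis.
From mathcomp Require Import measurable_realfun ring lra zify.
Import Order.TTheory GRing.Theory Num.Theory.
Import numFieldNormedType.Exports.
Local Open Scope classical_set_scope.
Local Open Scope ring_scope.

Set Implicit Arguments.
Unset Strict Implicit.
Unset Printing Implicit Defensive.

(** For two configurations [xi] and [eta], the duality function of a finite
    window [-M, M] is a product over pairs of sites. Exchanging two neighbouring
    values of [xi], weighted by the jump rate of [xi], has the same effect on it
    as exchanging those of [eta], weighted by the jump rate of [eta]. Hence in
    the derivative of [s |-> E^x E^eta G_M(X_s, eta_(t-s))] only the two
    bonds at the boundary of the window survive, and these contribute only when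
    [X_s] has a particle near the boundary, or [eta_(t-s)] a site that is not
    full near the end beyond which the defects of [eta] are counted. At distance
    [j] from the initial particles and defects this has probability at most
    [(2wqt)^j / j!], which beats the bound [q^(2N(2M+1))] on [G_M] for [N]
    particles, so the duality relation holds in the limit [M -> oo]. The same
    argument, run with a full [eta], shows that [X_t] a.s. has exactly [N]
    particles, which turns the limit of [E^x G_M(X_t, eta)] into the sum over
    particle configurations. *)

(** * Sites, bonds and functions of finitely many sites *)

(** Both half-lines and the full line, and both duality functions, are handled by one statement. Off
    the lattice a dual configuration reads as empty and a primal one as full, so on a half-line
    every configuration is full far out on the side where defects are counted; on the full line the
    sets [left_full] and [right_full] provide exactly this. The generator is known on cylinder
    functions only, while [D_plus] and [D_minus] look at infinitely many sites and [D_minus] may be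
    infinite; hence the work in windows with an explicit radius. Returning from the window raises
    integrability: the window functions of [D_plus] are at most 1, but those of [D_minus] grow with
    the window. Their expectations stay bounded because growth occurs only when a defect has reached
    the newly added site, which again produces an exponential series. The double expectation is
    resolved into the finitely many local states of the dual process, so it is a finite sum of
    products and no joint process has to be built. *)

Section Lattice.
Context (n : nat) (Lam : pred int).
Implicit Types (xi eta : config n Lam) (z : int) (c : 'I_n.+1).

(* Outside the lattice a configuration is extended by a neutral value: [ord0]
   for the dual configuration, [ord_max] for the primal one. *)
Definition hat c xi z : 'I_n.+1 :=
  if (insub z : option (site Lam)) is Some k then xi k else c.

Definition bond_at z : option (site Lam * site Lam) :=
  if (insub z : option (site Lam), insub (z + 1) : option (site Lam))
    is (Some k, Some l) then Some (k, l) else None.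

Definition swap z xi : config n Lam :=
  if bond_at z is Some b then exchange xi b.1 b.2 else xi.

Lemma hat_val c xi (k : site Lam) : hat c xi (val k) = xi k.
Proof. by rewrite /hat valK. Qed.

Lemma hat_out c xi z : ~~ Lam z -> hat c xi z = c.
Proof. by move=> h; rewrite /hat insubN. Qed.

Lemma bond_at_val z b : bond_at z = Some b -> (val b.1 = z) * (val b.2 = z + 1).
Proof.
rewrite /bond_at; case: insubP => //= k _ <-; case: insubP => //= l _ <-.
by case=> <-.
Qed.

Lemma bond_atE b : bonds b -> bond_at (val b.1) = Some b.
Proof.
rewrite /bonds /bond_at /= => h; rewrite -h !valK.
by case: b {h}.
Qed.

Lemma hat_swap b z c xi y : bond_at z = Some b ->
  hat c (swap z xi) y = if y == z then hat c xi (z + 1)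
                        else if y == z + 1 then hat c xi z else hat c xi y.
Proof.
move=> bz; have [b1 b2] := bond_at_val bz.
have hz : hat c xi z = xi b.1 by rewrite -b1 hat_val.
have hz1 : hat c xi (z + 1) = xi b.2 by rewrite -b2 hat_val.
rewrite hz hz1 /swap bz.
have [Ly|Ly] := boolP (Lam y); last first.
  rewrite !hat_out//; case: eqP => [e|_].
    by move: Ly; rewrite e -b1 (valP b.1).
  by case: eqP => [e|_//]; move: Ly; rewrite e -b2 (valP b.2).
have -> : y = val (exist _ y Ly : site Lam) by [].
by rewrite !hat_val /exchange -!val_eqE b1 b2.
Qed.

Lemma swap_id c z xi : hat c xi z = hat c xi (z + 1) -> swap z xi = xi.
Proof.
case bz : (bond_at z) => [b|]; last by rewrite /swap bz.
have [b1 b2] := bond_at_val bz; rewrite /swap bz.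
rewrite -{1}b1 -b2 !hat_val => e.
apply/funext => j; rewrite /exchange; case: eqP => [->//|_].
by case: eqP => [->|].
Qed.

Lemma swap_out z xi (k : site Lam) : val k != z -> val k != z + 1 ->
  swap z xi k = xi k.
Proof.
move=> kz kz1; rewrite -(hat_val ord0 (swap _ _)) -(hat_val ord0 xi).
case bz : (bond_at z) => [b|]; last by rewrite /swap bz.
by rewrite (hat_swap _ _ _ bz) (negPf kz) (negPf kz1).
Qed.

(** Cylinder functions with an explicit radius, since the size of a window is later weighed against
    the probability of reaching its edge. *)
Definition depends_on T (M : nat) (f : config n Lam -> T) :=
  forall xi eta, (forall k, (absz (val k) <= M)%N -> xi k = eta k) ->
  f xi = f eta.

Lemma depends_onS T M M' (f : config n Lam -> T) : (M <= M')%N ->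
  depends_on M f -> depends_on M' f.
Proof.
by move=> h df xi eta e; apply: df => k hk; apply: e; apply: leq_trans h.
Qed.

Lemma depends_on_cst T M (x : T) : depends_on M (fun=> x).
Proof. by []. Qed.

Lemma depends_on_hat M c z : (absz z <= M)%N -> depends_on M (hat c ^~ z).
Proof.
move=> zM xi eta e; rewrite /hat; case: insubP => //= k _ ek.
by apply: e; have -> : val k = z by exact: ek.
Qed.

Lemma depends_on_swap T M z (f : config n Lam -> T) :
  depends_on M f -> (absz z <= M.+1)%N -> depends_on M.+2 (f \o swap z).
Proof.
move=> df zM xi eta e; apply: df => k kM; rewrite /swap.
case bz : (bond_at z) => [b|]; last by apply: e; lia.
have [b1 b2] := bond_at_val bz.
rewrite /exchange; case: ifP => _; first by apply: e; rewrite b2; lia.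
by case: ifP => _; apply: e; rewrite ?b1; lia.
Qed.

Lemma depends_on_swapN T M z (f : config n Lam -> T) xi :
  depends_on M f -> ~~ (- M.+1%:Z <= z <= M%:Z) -> f (swap z xi) = f xi.
Proof.
by move=> df zM; apply: df => k kM; apply: swap_out; apply/eqP; lia.
Qed.

Definition zrange (M : nat) : seq int :=
  [seq i%:Z - M%:Z | i <- iota 0 M.*2.+1].

Lemma zrange_uniq M : uniq (zrange M).
Proof. by rewrite map_inj_uniq ?iota_uniq// => i j; lia. Qed.

Lemma zrange_sorted M : sorted (fun x y : int => x < y) (zrange M).
Proof.
rewrite /zrange; have := iota_ltn_sorted 0 M.*2.+1.
by rewrite sorted_map; apply: sub_sorted => i j /= ij; rewrite ltrD2r ltz_nat.
Qed.

Lemma mem_zrange M z : (z \in zrange M) = (absz z <= M)%N.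
Proof.
apply/mapP/idP => [[i]|zM]; first by rewrite mem_iota => h ->; lia.
exists (absz (z + M%:Z)); last lia.
by rewrite mem_iota; lia.
Qed.

Lemma zrangeS M : zrange M.+1 = - M.+1%:Z :: rcons (zrange M) M.+1%:Z.
Proof.
rewrite /zrange (_ : M.+1.*2.+1 = 1 + (M.*2.+1 + 1))%N; last lia.
rewrite !iotaD !map_cat cat1s cats1; congr (_ :: rcons _ _); [lia| |lia].
rewrite -[(0 + 1)%N]addn0 iotaDl -map_comp; apply: eq_map => i /=; lia.
Qed.

Lemma zrange_split M z : - M%:Z <= z < M%:Z -> exists s1 s2,
  zrange M = s1 ++ [:: z, z + 1 & s2].
Proof.
move=> zM; pose i := absz (z + M%:Z).
exists [seq j%:Z - M%:Z | j <- iota 0 i].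
exists [seq j%:Z - M%:Z | j <- iota i.+2 (M.*2.+1 - i.+2)%N].
have e : M.*2.+1 = (i + (2 + (M.*2.+1 - i.+2)))%N by lia.
rewrite /zrange {1}e iotaD map_cat; congr (_ ++ _).
by rewrite iotaD map_cat /= !addnS !addn0; congr (_ :: _ :: _); lia.
Qed.

Lemma is_cylinderP (R : realType) (f : config n Lam -> R) :
  is_cylinder f <-> exists M, depends_on M f.
Proof.
split=> [[A /finite_seqP[s ->] fA]|[M fM]].
  exists (\max_(k <- s) absz (val k))%N => xi eta e; apply: fA => k /= ks.
  by apply: e; apply: (@leq_bigmax_seq _ _ predT).
exists [set k | (absz (val k) <= M)%N]; last exact: fM.
apply: (@sub_finite_set _ _
    [set` pmap (insub : int -> option (site Lam)) (zrange M)]); last first.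
  exact: finite_seq.
move=> k kM; rewrite mksetE mem_pmap; apply/mapP; exists (val k).
  by rewrite mem_zrange.
by rewrite valK.
Qed.

Definition local_state M := {ffun 'I_M.*2.+1 -> 'I_n.+1}.

Definition restr M xi : local_state M := [ffun i : 'I_M.*2.+1 => hat ord0 xi (i%:Z - M%:Z)].

(* Only the values of [ext zeta] on the sites of the window are meaningful. *)
Definition ext M (zeta : local_state M) : config n Lam :=
  fun k => zeta (inord (absz (val k + M%:Z))).

Lemma ext_restr M xi (k : site Lam) : (absz (val k) <= M)%N ->
  ext (restr M xi) k = xi k.
Proof.
move=> kM; rewrite /ext ffunE inordK; last lia.
by rewrite -[RHS](hat_val ord0); congr hat; lia.
Qed.

Lemma depends_ext T M (f : config n Lam -> T) xi : depends_on M f ->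
  f (ext (restr M xi)) = f xi.
Proof. by apply => k; exact: ext_restr. Qed.

Lemma depends_on_restr M : depends_on M (restr M).
Proof.
move=> xi eta e; apply/ffunP => i; rewrite !ffunE.
by apply: depends_on_hat e; have := ltn_ord i; lia.
Qed.

Lemma depends_on_hat1 M c z (T : Type) (g : 'I_n.+1 -> T) : (absz z <= M)%N ->
  depends_on M (fun xi => g (hat c xi z)).
Proof. by move=> zM xi eta /(depends_on_hat c zM) ->. Qed.

End Lattice.

Section GeneratorFormula.
Context {R : realType} (n : nat) (Lam : pred int) (w q : R).
Implicit Types (xi eta : config n Lam) (z : int) (f : config n Lam -> R).

Definition bond_rate z xi : R :=
  if bond_at Lam z is Some b then rate w q xi b.1 b.2 else 0.

Definition bond_term f z xi : R := bond_rate z xi * (f (swap z xi) - f xi).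

(** Bonds are indexed by their left ends. A bond missing from [s] contributes nothing because [f]
    does not see its exchange, and an integer that starts no bond has rate 0. *)
Lemma generatorE f (s : seq int) xi : uniq s ->
  (forall z, z \notin s -> forall eta, f (swap z eta) = f eta) ->
  generator w q f xi = \sum_(z <- s) bond_term f z xi.
Proof.
move=> us fs; rewrite /generator (fsbigE (pmap (bond_at Lam) s)).
- rewrite big_seq_cond (eq_bigl (fun b => b \in pmap (bond_at Lam) s)); last first.
    move=> b; apply: andb_idr; rewrite mem_pmap => /mapP[z _ /esym bz].
    by have [b1 b2] := bond_at_val bz; rewrite inE /bonds/= b1.
  rewrite -big_seq; elim: s {us fs} => [|z s IH]; first by rewrite !big_nil.
  rewrite big_cons /= /bond_term /bond_rate /swap; case: bond_at => [b|] /=.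
    by rewrite big_cons IH.
  by rewrite mul0r add0r.
(* The left end of a bond is the partial inverse of [bond_at] that uniqueness asks for. *)
- apply: (pmap_uniq _ us) => z; rewrite /oapp.
  by instantiate (1 := fun b => val b.1); case bz: bond_at => [b|]//; rewrite (bond_at_val bz).
- move=> b /=; rewrite mem_pmap => /mapP[z _ /esym /bond_at_val [b1 b2]].
  by rewrite /bonds/= b1.
- move=> b bb; rewrite mem_pmap => bs.
  have := bond_atE bb => eb.
  have /fs : val b.1 \notin s.
    by apply: contra bs => bs; apply/mapP; exists (val b.1).
  move=> /(_ xi); rewrite /swap eb => ->.
  by rewrite subrr mulr0.
Qed.

End GeneratorFormula.

Section RateBounds.
Context {R : realType} (n : nat) (Lam : pred int) (w q : R).
Implicit Types (xi eta : config n Lam) (z : int).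

Lemma depends_on_bond_rate M z : (absz z <= M)%N -> (absz (z + 1)%R <= M)%N ->
  depends_on M (@bond_rate R n Lam w q z).
Proof.
move=> zM z1M xi eta e; rewrite /bond_rate.
case bz : bond_at => [b|//]; have [b1 b2] := bond_at_val bz.
by rewrite /rate !e ?b1 ?b2.
Qed.

Lemma depends_on_generator M (f : config n Lam -> R) :
  depends_on M f -> depends_on M.+2 (generator w q f).
Proof.
move=> df xi eta e.
have fs z : z \notin zrange M.+1 -> forall eta, f (swap z eta) = f eta.
  rewrite mem_zrange => zM zeta; apply: depends_on_swapN df _; lia.
rewrite !(generatorE _ _ _ (zrange_uniq M.+1) fs).
apply: eq_big_seq => z; rewrite mem_zrange => zM; rewrite /bond_term.
rewrite (depends_on_bond_rate _ _ e); [|lia|lia].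
rewrite -[f (swap z xi)]/((f \o swap z) xi) (depends_on_swap df zM e)/=.
by rewrite (depends_onS _ df e)//; lia.
Qed.

Hypotheses (hw : 0 < w) (hq : 1 <= q).

Let wq_ge0 : 0 <= w * q.
Proof. by rewrite mulr_ge0 ?ltW// (lt_le_trans _ hq). Qed.

Lemma rateE xi (k l : site Lam) : rate w q xi k l =
  if xi k == xi l then 0 else w * (if (xi l < xi k)%N then q else q^-1).
Proof.
rewrite /rate; case: eqP => [->|/eqP ne]; first by rewrite subrr sgz0 expr0z subrr mulr0.
rewrite subr0; congr (_ * _); case: ltnP => lt.
  by rewrite gtr0_sgz ?expr1z// subr_gt0 ltz_nat.
rewrite ltr0_sgz; first by rewrite exprN1.
rewrite subr_lt0 ltz_nat ltn_neqAle lt andbT.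
by apply: contraNN ne => /eqP/val_inj ->.
Qed.

Lemma rate_bounds xi (k l : site Lam) : 0 <= rate w q xi k l <= w * q.
Proof.
have q0 : 0 < q by apply: lt_le_trans hq.
rewrite rateE; apply/andP; case: eqP => _; first by rewrite lexx mulr_ge0 ?ltW.
split; first by rewrite mulr_ge0 ?ltW//; case: ifP => _; rewrite ?invr_gt0.
rewrite ler_pM2l//; case: ifP => // _; apply: le_trans hq.
by rewrite invf_le1.
Qed.

Lemma bond_rate_bounds z xi : 0 <= bond_rate w q z xi <= w * q.
Proof.
rewrite /bond_rate; case: bond_at => [b|]; first exact: rate_bounds.
by rewrite lexx wq_ge0.
Qed.

(** Only the two bonds at [z] act. Exchanging along one of them brings in the neighbour's value at
    rate at most [w * q]; the term for a deviation leaving [z] is nonpositive and is dropped. *)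
Lemma generator_occupied c z xi :
  generator w q (fun eta => (hat c eta z != c)%:R) xi <=
  w * q * ((hat c xi (z - 1) != c)%:R + (hat c xi (z + 1) != c)%:R).
Proof.
rewrite (@generatorE _ _ _ _ _ _ [:: z - 1; z]); last 2 first.
- by rewrite /= inE andbT; apply/eqP; lia.
- move=> y; rewrite !inE => /norP[y1 y2] eta; congr (_ %:R); congr (nat_of_bool _).
  congr (_ != _); case by_ : (bond_at Lam y) => [b|]; last by rewrite /swap by_.
  by rewrite (hat_swap _ _ _ by_) ifN ?ifN// eq_sym; apply/eqP => h;
    [move/eqP: y1; apply|move/eqP: y2; apply]; lia.
rewrite !big_cons big_nil addr0 mulrDr; apply: lerD.
- rewrite /bond_term; case bz : (bond_at Lam (z - 1)) => [b|]; last first.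
    by rewrite {1}/bond_rate bz mul0r mulr_ge0.
  have /andP[r0 r1] := bond_rate_bounds (z - 1) xi.
  rewrite (hat_swap _ _ _ bz) ifN; last by apply/eqP; lia.
  rewrite ifT; last by apply/eqP; lia.
  apply: le_trans (_ : bond_rate w q (z - 1) xi * (hat c xi (z - 1) != c)%:R <= _).
    by rewrite ler_wpM2l// lerBlDr lerDl.
  by rewrite ler_wpM2r.
- rewrite /bond_term; case bz : (bond_at Lam z) => [b|]; last first.
    by rewrite {1}/bond_rate bz mul0r mulr_ge0.
  have /andP[r0 r1] := bond_rate_bounds z xi.
  rewrite (hat_swap _ _ _ bz) eqxx.
  apply: le_trans (_ : bond_rate w q z xi * (hat c xi (z + 1) != c)%:R <= _).
    by rewrite ler_wpM2l// lerBlDr lerDl.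
  by rewrite ler_wpM2r.
Qed.

End RateBounds.

(** * Expectations of functions of finitely many sites *)

Section Cylinder.
Context {R : realType} (n : nat) (Lam : pred int).

Lemma nbhs_window M (xi : config n Lam) :
  nbhs xi [set eta : config n Lam | restr M eta = restr M xi].
Proof.
have loc z : \forall eta \near xi, hat ord0 eta z = hat ord0 xi z.
  have [Lz|Lz] := boolP (Lam z); last by near=> eta; rewrite !hat_out.
  pose k : site Lam := exist _ z Lz.
  have h : nbhs xi ((fun eta : config n Lam => eta k) @^-1` [set xi k]).
    apply: (@proj_continuous (site Lam) (fun=> discrete_topology 'I_n.+1) k xi).
    exact: discrete_set1.
  by apply: filterS h => eta /= e; rewrite -[z]/(val k) !hat_val.
have := @filter_forall _ 'I_M.*2.+1 (fun i (eta : config n Lam) =>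
  hat ord0 eta (i%:Z - M%:Z) = hat ord0 xi (i%:Z - M%:Z)) (nbhs xi) (nbhs_filter xi)
  (fun i => loc (i%:Z - M%:Z)).
move=> /filterS; apply => eta e; apply/ffunP => i; rewrite !ffunE; exact: e.
Unshelve. all: by end_near. Qed.

(** A set of configurations determined by finitely many sites is open in the product of discrete
    topologies, hence Borel. *)
Lemma depends_on_measurable T M (f : config n Lam -> T) (Y : set T) :
  depends_on M f -> measurable (f @^-1` Y).
Proof.
move=> df; apply: sub_sigma_algebra; rewrite openE => xi /= Yxi.
rewrite /interior; apply: filterS (nbhs_window M xi) => eta /= e.
by rewrite -(depends_ext eta df) e (depends_ext xi df).
Qed.

End Cylinder.

Section Expectation.
Context {R : realType} (n : nat) (Lam : pred int).
Context (d : measure_display) (Omega : measurableType d).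
Variables (P : config n Lam -> probability Omega R).
Variables (X : R -> Omega -> config n Lam).
Hypothesis HM : is_markov P X.
Implicit Types (xi eta : config n Lam) (f g : config n Lam -> R).

Local Notation E := (semigroup P X).

Lemma depends_bounded M f : depends_on M f -> exists C, forall xi, `|f xi| <= C.
Proof.
move=> df; exists (\sum_(zeta : local_state n M) `|f (ext zeta)|) => xi.
rewrite -(depends_ext xi df) (bigD1 (restr M xi))//= lerDl.
by apply: sumr_ge0.
Qed.

Lemma state_measurable T t M (f : config n Lam -> T) (Y : set T) : 0 <= t ->
  depends_on M f -> measurable [set omega | Y (f (X t omega))].
Proof.
move=> t0 df; have [+ _ _ _] := HM => /(_ t t0) mX.
rewrite (_ : [set _ | _] = setT `&` X t @^-1` (f @^-1` Y)); last by rewrite setTI.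
by apply: mX => //; apply: depends_on_measurable df.
Qed.

Lemma state_measurable_fun t M f : 0 <= t -> depends_on M f ->
  measurable_fun setT (fun omega => f (X t omega)).
Proof. by move=> t0 df _ Y _; rewrite setTI; apply: state_measurable df. Qed.

Lemma state_integrable t M f xi : 0 <= t -> depends_on M f ->
  (P xi).-integrable setT (EFin \o (fun omega => f (X t omega))).
Proof.
move=> t0 df; apply: measurable_bounded_integrable => //.
- by rewrite -ge0_fin_numE ?fin_num_measure.
- exact: state_measurable_fun df.
- have [C fC] := depends_bounded df; exists C; split; first exact: num_real.
  by move=> x Cx omega _; apply: le_trans (fC _) _; apply: ltW.
Qed.

Lemma expectD t M f g xi : 0 <= t -> depends_on M f -> depends_on M g ->
  E t (fun eta => f eta + g eta) xi = E t f xi + E t g xi.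
Proof.
by move=> t0 df dg; rewrite /semigroup RintegralD//; apply: state_integrable; eassumption.
Qed.

Lemma expectZ t M a f xi : 0 <= t -> depends_on M f ->
  E t (fun eta => a * f eta) xi = a * E t f xi.
Proof.
by move=> t0 df; rewrite /semigroup RintegralZl//; apply: state_integrable; eassumption.
Qed.

Lemma expectB t M f g xi : 0 <= t -> depends_on M f -> depends_on M g ->
  E t (fun eta => f eta - g eta) xi = E t f xi - E t g xi.
Proof.
by move=> t0 df dg; rewrite /semigroup RintegralB//; apply: state_integrable; eassumption.
Qed.

Lemma expect_cst t a xi : E t (fun=> a) xi = a.
Proof.
rewrite /semigroup Rintegral_cst// [X in fine X](_ : _ = 1%E) ?mulr1//.
exact: (@probability_setT _ _ _ (P xi)).
Qed.

Lemma le_expect t M f g xi : 0 <= t -> depends_on M f -> depends_on M g ->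
  (forall eta, f eta <= g eta) -> E t f xi <= E t g xi.
Proof.
by move=> t0 df dg fg; apply: le_Rintegral => //; apply: state_integrable; eassumption.
Qed.

Lemma expect_sum t M (I : Type) (s : seq I) (F : I -> config n Lam -> R) xi :
  0 <= t -> (forall i, depends_on M (F i)) ->
  E t (fun eta => \sum_(i <- s) F i eta) xi = \sum_(i <- s) E t (F i) xi.
Proof.
move=> t0 dF; elim: s => [|i s IH].
  rewrite big_nil -[RHS](expect_cst t 0 xi); congr (E t _ xi).
  by apply/funext => eta; rewrite big_nil.
rewrite big_cons -IH -(@expectD _ M)//; last first.
  by move=> eta eta' e; apply: eq_bigr => j _; apply: dF.
by congr (E t _ xi); apply/funext => eta; rewrite big_cons.
Qed.

Lemma depends_sum M f eta : depends_on M f ->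
  f eta = \sum_zeta f (ext zeta) * (restr M eta == zeta)%:R.
Proof.
move=> df; rewrite (bigD1 (restr M eta))//= eqxx mulr1 big1 ?addr0.
  by rewrite (depends_ext _ df).
by move=> zeta ne; rewrite eq_sym (negPf ne) mulr0.
Qed.

Lemma depends_on_state M (zeta : local_state n M) :
  depends_on M (fun eta : config n Lam => (restr M eta == zeta)%:R : R).
Proof. by move=> xi eta /depends_on_restr ->. Qed.

(** Seen through a window, the law of [X t] is a finite vector of probabilities. What [is_markov]
    says about events passes to cylinder functions through this linear combination. *)
Lemma expect_decomp t M f xi : 0 <= t -> depends_on M f ->
  E t f xi = \sum_(zeta : local_state n M)
    f (ext zeta) * E t (fun eta => (restr M eta == zeta)%:R) xi.
Proof.
move=> t0 df; rewrite {1}(_ : f = fun eta => \sum_(zeta : local_state n M)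
    f (ext zeta) * (restr M eta == zeta)%:R); last first.
  by apply/funext => eta; exact: depends_sum.
rewrite (@expect_sum _ M)//; last first.
  by move=> zeta eta eta' /depends_on_restr ->.
apply: eq_bigr => zeta _; apply: (@expectZ _ M) => //.
exact: depends_on_state.
Qed.

Lemma expect_indic t M (zeta : local_state n M) xi : 0 <= t ->
  E t (fun eta => (restr M eta == zeta)%:R) xi =
  fine (P xi (X t @^-1` [set eta | restr M eta = zeta])).
Proof.
move=> t0; rewrite /semigroup /Rintegral.
rewrite (eq_integral (EFin \o \1_(X t @^-1` [set eta | restr M eta = zeta]))).
  rewrite integral_indic ?setIT//.
  exact: (state_measurable [set zeta] t0 (@depends_on_restr n Lam M)).
move=> omega _ /=; rewrite indicE; congr (_%:R%:E); congr nat_of_bool.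
by apply/eqP/idP; rewrite inE.
Qed.

Lemma measurable_expect M f s t xi : 0 <= s -> 0 <= t -> depends_on M f ->
  measurable_fun setT (fun omega => E s f (X t omega)).
Proof.
move=> s0 t0 df.
under eq_fun do rewrite (expect_decomp _ s0 df).
apply: measurable_sum => zeta; apply: measurable_funM => //.
under eq_fun do rewrite expect_indic//.
apply: (@measurableT_comp _ _ _ _ _ _ fine) => //.
have [mX _ + _] := HM.
move=> /(_ s [set eta | restr M eta = zeta] s0 _) mP.
apply: (@measurableT_comp _ _ _ _ _ _ (fun eta => P eta _)) => //; last exact: mX.
apply: mP.
exact: (@depends_on_measurable _ _ _ _ _ [set zeta] (@depends_on_restr _ _ M)).
Qed.

End Expectation.

Section RintegralSum.
Context d (T : measurableType d) (R : realType) (mu : {measure set T -> \bar R}).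

Lemma Rintegral_sum (D : set T) (mD : measurable D) (I : Type) (s : seq I)
    (F : I -> T -> R) :
  (forall i, mu.-integrable D (EFin \o F i)) ->
  (\int[mu]_(x in D) \sum_(i <- s) F i x) = \sum_(i <- s) \int[mu]_(x in D) F i x.
Proof.
move=> iF; rewrite /Rintegral.
under eq_integral do rewrite -sumEFin.
rewrite integral_sum//.
by rewrite sum_fine// => i _; apply: integrable_fin_num => //; exact: iF.
Qed.

End RintegralSum.

(** * The semigroup on cylinder functions: Markov property and behaviour at time 0 *)

Section MarkovSemigroup.
Context {R : realType} (n : nat) (Lam : pred int) (w q : R).
Context (d : measure_display) (Omega : measurableType d).
Variables (P : config n Lam -> probability Omega R).
Variables (X : R -> Omega -> config n Lam).
Hypothesis HA : is_priority_asep P X w q.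
Implicit Types (xi eta : config n Lam) (f g : config n Lam -> R).

Local Notation E := (semigroup P X).
Let HM : is_markov P X. Proof. by case: HA. Qed.

Lemma expect_norm_le t M f (C : R) xi : 0 <= t -> depends_on M f ->
  (forall eta, `|f eta| <= C) -> `|E t f xi| <= C.
Proof.
move=> t0 df fC; rewrite ler_norml; apply/andP; split.
  rewrite -[leLHS](expect_cst P X t _ xi).
  apply: (le_expect HM _ t0 (@depends_on_cst _ _ _ M _) df) => eta.
  by have := fC eta; rewrite ler_norml => /andP[].
rewrite -[leRHS](expect_cst P X t _ xi).
apply: (le_expect HM _ t0 df (@depends_on_cst _ _ _ M _)) => eta.
by have := fC eta; rewrite ler_norml => /andP[].
Qed.

Lemma integrable_expect s t M f xi : 0 <= s -> 0 <= t -> depends_on M f ->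
  (P xi).-integrable setT (EFin \o (fun omega => E t f (X s omega))).
Proof.
move=> s0 t0 df; apply: measurable_bounded_integrable => //.
- by rewrite -ge0_fin_numE ?fin_num_measure.
- exact: measurable_expect df.
- have [C fC] := depends_bounded df; exists C; split; first exact: num_real.
  move=> x Cx omega _; apply: le_trans (expect_norm_le _ _ _ fC) _ => //.
    by eassumption.
  exact: ltW.
Qed.

(** The Markov property with the trivial history event [setT] is the case of the indicator of a
    local state; linearity gives the rest. *)
Lemma expect_markov s t M f xi : 0 <= s -> 0 <= t -> depends_on M f ->
  E (s + t) f xi = \int[P xi]_(omega in setT) E t f (X s omega).
Proof.
move=> s0 t0 df; rewrite (expect_decomp HM _ _ df) ?addr_ge0//.
under [RHS]eq_Rintegral do rewrite (expect_decomp HM _ t0 df).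
rewrite Rintegral_sum//; last first.
  move=> zeta; rewrite (_ : _ \o _ = EFin \o (fun omega => E t
      (fun eta => f (ext zeta) * (restr M eta == zeta)%:R) (X s omega))).
    apply: (@integrable_expect _ _ M) => //.
    by move=> eta eta' /depends_on_restr ->.
  apply/funext => omega /=; congr (_%:E).
  by rewrite (expectZ HM (M := M))//; exact: depends_on_state.
apply: eq_bigr => zeta _; rewrite RintegralZl//; last first.
  by apply: (@integrable_expect _ _ M) => //; exact: depends_on_state.
congr (_ * _); rewrite (expect_indic HM) ?addr_ge0//.
have [_ _ _] := HM => /(_ xi s t setT [set eta | restr M eta = zeta] s0 t0) h.
rewrite setTI in h; rewrite h.
- rewrite /Rintegral; congr fine; apply: eq_integral => omega _.
  rewrite (expect_indic HM)// fineK// fin_num_measure//.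
  exact: (state_measurable HM [set zeta] t0 (@depends_on_restr n Lam M)).
- by rewrite /history; exact: (@measurableT _ (g_sigma_algebraType _)).
- exact: (@depends_on_measurable _ _ _ _ _ [set zeta] (@depends_on_restr _ _ M)).
Qed.

Lemma point_measurable t xi : 0 <= t ->
  measurable [set omega | X t omega = xi].
Proof.
move=> t0; rewrite (_ : [set _ | _] =
    \bigcap_M [set omega | restr M (X t omega) = restr M xi]); last first.
  apply/seteqP; split=> omega /=; first by move=> e M _ /=; rewrite e.
  move=> h; apply/funext => k; have := h (absz (val k)) I.
  by move=> /(congr1 (fun z => ext z k)); rewrite !ext_restr.
apply: bigcap_measurable => [|M _]; first by exists 0%N.
exact: (state_measurable HM [set restr M xi] t0 (@depends_on_restr n Lam M)).
Qed.

Lemma expect0 M f xi : depends_on M f -> E 0 f xi = f xi.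
Proof.
move=> df; rewrite /semigroup -[RHS](expect_cst P X 0 (f xi) xi) /semigroup /Rintegral.
congr fine; apply: ae_eq_integral => //.
- exact/measurable_EFinP/(state_measurable_fun HM _ df).
- have [_ h _ _] := HM; have {h} := h xi.
  move=> h; have mB : measurable [set omega | f (X 0 omega) = f xi].
    exact: (state_measurable HM [set f xi] (lexx 0) df).
  exists (~` [set omega | f (X 0 omega) = f xi]); split.
  + exact: measurableC.
  + suff PB : P xi [set omega | f (X 0 omega) = f xi] = 1%E.
      by apply: etrans (probability_setC (P xi) mB) _; rewrite PB subee.
    apply/eqP; rewrite eq_le probability_le1//= -[leLHS]h.
    apply: le_measure; rewrite ?inE//; first exact: point_measurable.
    by move=> omega /= ->.
  + by move=> omega /= /not_implyP[_ ne] e; apply: ne; rewrite e.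
Qed.

Lemma generator_unif M f : depends_on M f -> forall eps : R, 0 < eps ->
  exists2 delta, 0 < delta & forall t, 0 < t < delta -> forall eta,
    `|(E t f eta - f eta) / t - generator w q f eta| <= eps.
Proof.
move=> df eps e0; have [_ _ /(_ f)] := HA.
have cf : is_cylinder f by apply/is_cylinderP; exists M.
move=> /(_ cf) /(_ [set g | forall eta, `|g eta - generator w q f eta| <= eps]).
case.
  apply/uniform_nbhs; exists [set xy : R * R | `|xy.1 - xy.2| <= eps]; split.
    rewrite -entourage_ballE; exists eps => //= -[a b]; rewrite /ball/= => /ltW.
    by rewrite distrC.
  by move=> g /= + eta; move=> /(_ eta Logic.I); rewrite distrC.
move=> delta /= d0 h; exists delta => // t /andP[t0 td] eta.
apply: h => //=; by rewrite sub0r normrN gtr0_norm.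
Qed.

End MarkovSemigroup.

(** * Kolmogorov equations *)

Section Kolmogorov.
Context {R : realType} (n : nat) (Lam : pred int) (w q : R).
Context (d : measure_display) (Omega : measurableType d).
Variables (P : config n Lam -> probability Omega R).
Variables (X : R -> Omega -> config n Lam).
Hypothesis HA : is_priority_asep P X w q.
Implicit Types (xi eta : config n Lam) (f g : config n Lam -> R).

Local Notation E := (semigroup P X).
Let HM : is_markov P X. Proof. by case: HA. Qed.

(* The estimate is uniform in [s], which yields two-sided derivatives below. *)
Lemma expect_increment M f (eps : R) : depends_on M f -> 0 < eps ->
  exists2 delta, 0 < delta & forall s t xi, 0 <= s -> 0 < t < delta ->
    `|E (s + t) f xi - E s f xi - t * E s (generator w q f) xi| <= eps * t.
Proof.
move=> df e0; have [delta d0 h] := generator_unif HA df e0.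
exists delta => // s t xi s0 td; have /andP[t0 _] := td.
have dL := @depends_on_generator R n Lam w q M f df.
rewrite (expect_markov HA _ s0 (ltW t0) df) -(expectZ HM _ _ s0 dL).
have i1 := integrable_expect HA xi s0 (ltW t0) df.
have i2 := state_integrable HM xi s0 df.
have dtL : depends_on M.+2 (fun eta => t * generator w q f eta).
  by move=> eta eta' /dL ->.
have i3 := state_integrable HM xi s0 dtL.
rewrite /semigroup -!RintegralB//; last first.
  by have := integrableB measurableT i1 i2; apply: eq_integrable.
apply: (le_trans (le_normr_Rintegral _ _)) => //.
  have := integrableB measurableT (integrableB measurableT i1 i2) i3.
  by apply: eq_integrable.
rewrite -[leRHS](expect_cst P X s (eps * t) xi).
apply: le_Rintegral => //.
- have := integrable_abse (integrableB measurableT (integrableB measurableT i1 i2) i3).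
  by apply: eq_integrable.
- exact: (state_integrable HM xi s0 (@depends_on_cst _ _ _ M (eps * t))).
- move=> omega _ /=; have := h t td (X s omega).
  rewrite -(ler_pM2r t0); apply: le_trans.
  rewrite -[X in _ <= _ * X](gtr0_norm t0) -normrM mulrBl divfK ?gt_eqF//.
  by rewrite [_ * t]mulrC.
Qed.

Lemma expect_lipschitz M f : depends_on M f ->
  exists2 C, 0 < C & forall s t xi, 0 <= s -> 0 <= t ->
    `|E (s + t) f xi - E s f xi| <= C * t.
Proof.
move=> df; have [delta d0 h] := expect_increment df ltr01.
have dL := @depends_on_generator R n Lam w q M f df.
have [C0 fC0] := depends_bounded df; have [C1 LC1] := depends_bounded dL.
have C00 : 0 <= C0 by apply: le_trans (fC0 (fun=> ord0)).
have C10 : 0 <= C1 by apply: le_trans (LC1 (fun=> ord0)).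
(* For [t < delta] the increment estimate with error 1 gives the slope [1 + C1]; for [t >= delta]
   the trivial bound [2 * C0] is at most [2 * C0 / delta * t]. *)
exists (1 + C1 + 2 * C0 / delta) => [|s t xi s0 t0].
  by rewrite -addrA ltr_wpDr// addr_ge0// !mulr_ge0// invr_ge0 ltW.
have [->|tn0] := eqVneq t 0; first by rewrite addr0 subrr normr0 mulr0.
have tp : 0 < t by rewrite lt_neqAle eq_sym tn0.
have [td|dt] := ltP t delta.
  have {h} := h s t xi s0; rewrite tp td => /(_ isT).
  have := expect_norm_le HA xi s0 dL LC1.
  move=> h1 h2; apply: (@le_trans _ _ (1 * t + t * C1)).
    rewrite -[X in `|X|](subrK (t * E s (generator w q f) xi)).
    apply: le_trans (ler_normD _ _) _; apply: lerD => //.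
    by rewrite normrM gtr0_norm// ler_pM2l.
  rewrite -[t * C1]mulrC -mulrDl ler_pM2r// lerDl.
  by rewrite !mulr_ge0// invr_ge0 ltW.
apply: (@le_trans _ _ (2 * C0)).
  apply: le_trans (ler_normB _ _) _; rewrite mulrDl mul1r.
  by apply: lerD; apply: (expect_norm_le HA _ _ df fC0); rewrite ?addr_ge0.
apply: (@le_trans _ _ (2 * C0 / delta * t)).
  by rewrite -mulrA ler_peMr ?mulr_ge0// mulrC ler_pdivlMr// mul1r.
by rewrite ler_pM2r// lerDr addr_ge0.
Qed.

(** For [h > 0] the increment estimate from time [s] applies. For [h < 0] it is applied from
    [s + h], and the Lipschitz bound for the generator term moves that term from [s + h] back to
    [s]. The maximum with 0 extends the function to all real times. *)
Lemma expect_derive M f (s : R) xi : depends_on M f -> 0 < s ->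
  is_derive s 1 (fun t : R => E (Num.max 0 t) f xi) (E s (generator w q f) xi).
Proof.
move=> df s0; set F := fun t : R => _; set l := E s _ _.
have dL := @depends_on_generator R n Lam w q M f df.
suff cv : h^-1 *: (F (h *: 1 + s) - F s) @[h --> 0^'] --> l.
  by split; [exact: (cvgP _ cv)|exact: cvg_lim cv].
apply/cvgrPdist_le => eps e0.
have e20 : 0 < eps / 2 by rewrite divr_gt0.
have [delta d0 hd] := expect_increment df e20.
have [C C0 hC] := expect_lipschitz dL.
near=> h.
have hn0 : h != 0 by near: h; exact: nbhs_dnbhs_neq.
have hs : `|h| < s by near: h; apply: dnbhs0_lt.
have hdel : `|h| < delta by near: h; apply: dnbhs0_lt.
have hC' : `|h| < eps / 2 / C by near: h; apply: dnbhs0_lt; rewrite !divr_gt0.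
rewrite -[_%:A]/(h * 1) mulr1 -[_ *: _]/(h^-1 * _).
have sh : 0 < s + h by move: hs; rewrite ltr_norml => /andP[]; lra.
have -> : F s = E s f xi by rewrite /F max_r// ltW.
have -> : F (h + s) = E (s + h) f xi by rewrite /F addrC max_r// ltW.
rewrite -(ler_pM2r (_ : 0 < `|h|)) ?normr_gt0// -normrM mulrBl mulrAC mulVf// mul1r.
have [hp|hp] := ltP 0 h.
  rewrite (gtr0_norm hp) in hdel *.
  have := hd s h xi (ltW s0); rewrite hp hdel => /(_ isT).
  rewrite -/l distrC [h * l]mulrC => /le_trans; apply.
  by rewrite ler_pM2r//; lra.
have {}hp : h < 0 by rewrite lt_neqAle hn0.
rewrite (ltr0_norm hp) in hdel hC' *.
have := hd (s + h) (- h) xi (ltW sh); rewrite oppr_gt0 hp hdel => /(_ isT).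
have := hC (s + h) (- h) xi (ltW sh); rewrite oppr_ge0 (ltW hp) => /(_ isT).
rewrite addrK -/l; set l' := E (s + h) _ _ => h1 h2.
have h3 : `|l - l'| * (- h) <= eps / 2 * (- h).
  rewrite ler_pM2r ?oppr_gt0//; apply: le_trans h1 _.
  by rewrite mulrC -ler_pdivlMr// ltW.
have -> : l * h - (E (s + h) f xi - E s f xi) =
  (E s f xi - E (s + h) f xi - - h * l') + (l - l') * h by ring.
apply: le_trans (ler_normD _ _) _.
rewrite normrM (ltr0_norm hp); apply: le_trans (lerD h2 h3) _.
by rewrite -mulrDl -splitr.
Unshelve. all: by end_near. Qed.

Lemma expect_continuous M f xi : depends_on M f ->
  continuous (fun t : R => E (Num.max 0 t) f xi).
Proof.
move=> df s; apply/cvgrPdist_le => eps e0.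
have [C C0 hC] := expect_lipschitz df.
near=> t.
have ts : `|s - t| <= eps / C.
  by near: t; apply: cvgr_dist_le; [exact: cvg_id|rewrite divr_gt0].
have key a b : a <= b ->
    `|E (Num.max 0 b) f xi - E (Num.max 0 a) f xi| <= C * (b - a).
  move=> ab; have mab : Num.max 0 a <= Num.max 0 b by rewrite ge_max !le_max lexx ab orbT.
  have := hC (Num.max 0 a) (Num.max 0 b - Num.max 0 a) xi.
  rewrite [_ + (_ - _)]addrC subrK le_max lexx subr_ge0 mab => /(_ isT isT) /le_trans; apply.
  by rewrite ler_pM2l//; case: (ltP 0 b) => ?; case: (ltP 0 a) => ?; lra.
have Cts : C * `|s - t| <= eps by rewrite mulrC -ler_pdivlMr.
apply: le_trans Cts; have [st|ts'] := leP s t.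
  by rewrite distrC [`|s - t|]distrC [`|t - s|]ger0_norm ?subr_ge0// key.
by rewrite [`|s - t|]gtr0_norm ?subr_gt0// key// ltW.
Unshelve. all: by end_near. Qed.

End Kolmogorov.

(** * Comparison with explicit bounds, and the speed of propagation *)

Section Comparison.
Context {R : realType} (n : nat) (Lam : pred int) (w q : R).
Hypotheses (hw : 0 < w) (hq : 1 <= q).
Context (d : measure_display) (Omega : measurableType d).
Variables (P : config n Lam -> probability Omega R).
Variables (X : R -> Omega -> config n Lam).
Hypothesis HA : is_priority_asep P X w q.
Implicit Types (xi eta : config n Lam) (f g : config n Lam -> R).

Local Notation E := (semigroup P X).
Let HM : is_markov P X. Proof. by case: HA. Qed.

(** Mean value theorem for the difference of the two sides: it starts nonpositive and its derivative
    on []0, t[] is nonpositive. *)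
Lemma expect_comparison M f xi (t : R) (g dg : R -> R) : 0 <= t ->
  depends_on M f -> continuous g -> (forall s : R, is_derive s 1 g (dg s)) ->
  f xi <= g 0 -> (forall s, 0 < s -> s < t -> E s (generator w q f) xi <= dg s) ->
  E t f xi <= g t.
Proof.
move=> t0 df cg dgE fg0 Ldg.
have [te0|tn0] := eqVneq t 0; first by rewrite te0 (expect0 HA xi df).
have {}t0 : 0 < t by rewrite lt_neqAle eq_sym tn0.
pose F := (fun s : R => E (Num.max 0 s) f xi).
have dF (s : R) : s \in `]0, t[%R ->
    is_derive s 1 (F - g) (E s (generator w q f) xi - dg s).
  rewrite in_itv/= => /andP[s0 _]; apply: is_deriveB.
  exact: (expect_derive HA xi df s0).
have cF : {within `[0, t], continuous (F - g)}.
  apply: continuous_subspaceT => s; apply: continuousB; last exact: cg.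
  by have := @expect_continuous R n Lam w q _ _ P X HA M f xi df; apply.
have [c] := MVT t0 dF cF; rewrite in_itv/= => /andP[c0 ct].
rewrite subr0 /F -![(_ - _ : _ -> _) _]/(_ - _) maxxx (expect0 HA xi df).
rewrite (max_r (ltW t0)) => h.
have : (E c (generator w q f) xi - dg c) * t <= 0.
  by rewrite mulr_le0_ge0 ?subr_le0 ?Ldg// ltW.
by rewrite -h; lra.
Qed.

(* Deviations from [c] can only enter through a neighbour, so reaching distance
   [j] costs the [j]-th term of an exponential series. *)
Lemma expect_occupied c (e : int) (r : nat) xi j z s :
  `|e| = 1 -> (forall y, r%:Z <= e * y -> hat c xi y = c) ->
  0 <= s -> (r + j)%:Z <= e * z ->
  E s (fun eta => (hat c eta z != c)%:R) xi <= (2 * w * q * s) ^+ j / j`!%:R.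
Proof.
move=> e1 xic; elim: j z s => [|j IH] z s s0 zr.
  rewrite expr0 fact0 divr1 -[leRHS](expect_cst P X s 1 xi).
  have dz : depends_on (absz z) (fun eta => (hat c eta z != c)%:R : R).
    exact: (depends_on_hat1 c (fun a => (a != c)%:R)).
  apply: (le_expect HM _ s0 dz) => // eta; by case: (_ != _).
have [K KE] : exists K, K = 2 * w * q by exists (2 * w * q).
move: zr; have ze : e = 1 \/ e = -1 by lia.
move=> zr; have dz M : (absz z <= M)%N -> depends_on M (fun eta => (hat c eta z != c)%:R : R).
  exact: (depends_on_hat1 c (fun a => (a != c)%:R)).
have K0 : 0 <= K by rewrite KE !mulr_ge0 ?ltW// (lt_le_trans _ hq).
rewrite (_ : _ / _ = (K ^+ j.+1 / j.+1`!%:R) * s ^+ j.+1); last first.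
  by rewrite -KE exprMn mulrAC.
have dz1 : depends_on (absz z).+2 (fun eta => (hat c eta (z - 1) != c)%:R : R).
  by apply: (depends_on_hat1 c (fun a => (a != c)%:R)); lia.
have dz2 : depends_on (absz z).+2 (fun eta => (hat c eta (z + 1) != c)%:R : R).
  by apply: (depends_on_hat1 c (fun a => (a != c)%:R)); lia.
(* The derivative of the claimed bound. Both neighbours of [z] satisfy the induction hypothesis at
   distance [j], and each contributes [w * q] times its bound, whence the factor 2 in [K]. *)
pose dg (s : R) := K * ((K * s) ^+ j / j`!%:R).
apply: (@expect_comparison (absz z) _ xi s
  (fun s => (K ^+ j.+1 / j.+1`!%:R) * s ^+ j.+1) dg) => //.
- exact: dz.
- move=> u; apply: (@continuous_comp _ _ _ (fun u : R => u ^+ j.+1) ( *%R _)).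
    exact: exprn_continuous.
  exact: mulrl_continuous.
- move=> u.
  have -> : (fun s : R => K ^+ j.+1 / j.+1`!%:R * s ^+ j.+1) =
      (K ^+ j.+1 / j.+1`!%:R) \*: (id ^+ j.+1).
    by apply/funext => v; rewrite /= !fctE.
  apply: is_derive_eq; rewrite /dg /= -[_ *: _]/(_ * _) -[_ *: _]/(_ * _) mulr1.
  have j0 : j.+1%:R != 0 :> R by rewrite pnatr_eq0.
  have jf0 : j`!%:R != 0 :> R by rewrite pnatr_eq0 -lt0n fact_gt0.
  rewrite factS natrM exprMn exprS.
  move: (K ^+ j) (u ^+ j) (j`!%:R) jf0 (j.+1%:R) j0 => a b f f0 e' e0.
  by field; rewrite f0 e0.
- rewrite expr0n mulr0 xic ?eqxx//; lia.
- move=> u u0 _; apply: le_trans (_ : E u (fun eta => w * q *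
    ((hat c eta (z - 1) != c)%:R + (hat c eta (z + 1) != c)%:R)) xi <= _).
    apply: (le_expect HM (M := (absz z).+2)) => //; first exact: ltW.
    + exact/depends_on_generator/dz.
    + by move=> eta eta' ee; rewrite (dz1 _ _ ee) (dz2 _ _ ee).
    + by move=> eta; apply: generator_occupied.
  rewrite (expectZ HM (M := (absz z).+2) _ _ (ltW u0)); last first.
    by move=> eta eta' ee; rewrite (dz1 _ _ ee) (dz2 _ _ ee).
  rewrite (expectD HM xi (ltW u0) dz1 dz2) /dg.
  have h1 := IH (z - 1) u (ltW u0); have h2 := IH (z + 1) u (ltW u0).
  rewrite -KE in h1 h2.
  apply: le_trans (_ : w * q * (((K * u) ^+ j / j`!%:R) + ((K * u) ^+ j / j`!%:R)) <= _).
    rewrite ler_wpM2l//; first by rewrite mulr_ge0 ?ltW// (lt_le_trans _ hq).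
    by apply: lerD; [apply: h1|apply: h2]; lia.
  move: (_ / _) => A; rewrite KE le_eqVlt; apply/orP; left; apply/eqP; ring.
Qed.
End Comparison.

Section SumOfFunctions.
Context {R : realType}.

Lemma is_derive_bigsum (I : Type) (r : seq I) (h : I -> R -> R) (dh : I -> R) (s : R) :
  (forall i, is_derive s 1 (h i) (dh i)) ->
  is_derive s 1 (fun u => \sum_(i <- r) h i u) (\sum_(i <- r) dh i).
Proof.
move=> hh; elim: r => [|i r IH].
  rewrite big_nil (_ : (fun _ => _) = cst 0); first exact: is_derive_cst.
  by apply/funext => u; rewrite big_nil.
rewrite big_cons (_ : (fun _ => _) = h i + (fun u => \sum_(j <- r) h j u)).
  exact: is_deriveD.
by apply/funext => u; rewrite big_cons.
Qed.

Lemma continuous_bigsum (I : Type) (r : seq I) (h : I -> R -> R) (s : R) :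
  (forall i, {for s, continuous (h i)}) ->
  {for s, continuous (fun u => \sum_(i <- r) h i u)}.
Proof.
move=> hh; elim: r => [|i r IH].
  rewrite (_ : (fun _ => _) = cst 0); first exact: cst_continuous.
  by apply/funext => u; rewrite big_nil.
rewrite (_ : (fun _ => _) = h i \+ (fun u => \sum_(j <- r) h j u)).
  exact: continuousD.
by apply/funext => u; rewrite /= big_cons.
Qed.

End SumOfFunctions.

(** * Functions of a dual and a primal configuration *)

Section DualityGap.
Context {R : realType} (n : nat) (Lam : pred int) (w q : R).
Context (d : measure_display) (Omega : measurableType d).
Variables (P : config n Lam -> probability Omega R).
Variables (X : R -> Omega -> config n Lam).
Hypothesis HA : is_priority_asep P X w q.
Implicit Types (xi eta : config n Lam) (f g : config n Lam -> R).

Local Notation E := (semigroup P X).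
Local Notation L := (generator w q).
Let HM : is_markov P X. Proof. by case: HA. Qed.

Lemma depends_generatorE M f xi : depends_on M f ->
  L f xi = \sum_(z <- zrange M.+1) bond_term w q f z xi.
Proof.
move=> df; apply: generatorE; first exact: zrange_uniq.
by move=> z; rewrite mem_zrange => zM zeta; apply: depends_on_swapN df _; lia.
Qed.

Lemma generator_sum M (I : Type) (s : seq I) (F : I -> config n Lam -> R)
    (a : I -> R) xi : (forall i, depends_on M (F i)) ->
  L (fun eta => \sum_(i <- s) a i * F i eta) xi = \sum_(i <- s) a i * L (F i) xi.
Proof.
move=> dF; rewrite (@depends_generatorE M); last first.
  by move=> eta eta' e; apply: eq_bigr => i _; rewrite (dF i _ _ e).
under [RHS]eq_bigr do rewrite (depends_generatorE _ (dF _)) mulr_sumr.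
rewrite exchange_big/=; apply: eq_bigr => z _; rewrite /bond_term.
rewrite -sumrB mulr_sumr; apply: eq_bigr => i _; ring.
Qed.

(** The generator acts on the first variable as a finite sum of exchanges, so linearity of the
    expectation in the second variable lets the two commute. *)
Lemma generator_expect M (F : config n Lam -> config n Lam -> R) u xi eta :
  0 <= u -> (forall zeta, depends_on M (F ^~ zeta)) ->
  (forall zeta, depends_on M (F zeta)) ->
  L (fun xi => E u (F xi) eta) xi = E u (fun zeta => L (F ^~ zeta) xi) eta.
Proof.
move=> u0 d1 d2; rewrite (@depends_generatorE M); last first.
  by move=> a b e; congr (E u _ eta); apply/funext => zeta; exact: d1.
transitivity (E u (fun zeta => \sum_(z <- zrange M.+1) bond_term w q (F ^~ zeta) z xi) eta).
  rewrite (expect_sum HM (M := M))//; last first.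
    by move=> z a b e; rewrite /bond_term (d2 _ _ _ e) (d2 xi _ _ e).
  apply: eq_bigr => z _; rewrite /bond_term -(expectB HM _ u0 (d2 _) (d2 _)).
  rewrite (expectZ HM (M := M))//.
  by move=> a b e; rewrite (d2 _ _ _ e) (d2 xi _ _ e).
by congr (E u _ eta); apply/funext => zeta; rewrite (depends_generatorE _ (d1 zeta)).
Qed.

(* The gap is the integral over [0, t] of the derivative of
   [s |-> E^x E^eta F(X_s, eta_(t-s))], a finite sum of products since [F]
   depends on finitely many sites. *)
Lemma duality_gap M M' (F : config n Lam -> config n Lam -> R) (h1 h2 : config n Lam -> R)
    (B1 B2 t : R) x eta : 0 <= t ->
  (forall zeta, depends_on M (F ^~ zeta)) ->
  (forall zeta, depends_on M (F zeta)) ->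
  depends_on M' h1 -> depends_on M' h2 ->
  (forall xi zeta, `|L (F ^~ zeta) xi - L (F xi) zeta| <= h1 xi + h2 zeta) ->
  (forall s, 0 <= s -> s <= t -> E s h1 x <= B1) ->
  (forall s, 0 <= s -> s <= t -> E s h2 eta <= B2) ->
  `|E t (F ^~ eta) x - E t (F x) eta| <= (B1 + B2) * t.
Proof.
move=> t0 d1 d2 dh1 dh2 hF hB1 hB2.
have [te0|tn0] := eqVneq t 0.
  by rewrite te0 (expect0 HA x (d1 eta)) (expect0 HA eta (d2 x)) subrr normr0 mulr0.
have {}t0 : 0 < t by rewrite lt_neqAle eq_sym tn0.
(* Resolving the dual process at time [s] into local states gives products of a factor in [s] and a
   factor in [t - s], which can be differentiated term by term. *)
pose ind (zeta : local_state n M) : config n Lam -> R :=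
  fun eta => (restr M eta == zeta)%:R.
have dind zeta : depends_on M (ind zeta) by exact: depends_on_state.
pose p zeta (s : R) := E (Num.max 0 s) (ind zeta) x.
pose g (zeta : local_state n M) (s : R) := E (Num.max 0 s) (F (ext zeta)) eta.
pose h zeta (s : R) : R := p zeta s * g zeta (t - s).
pose Phi (s : R) := \sum_zeta h zeta s.
pose dPhi (s : R) := \sum_zeta (E s (L (ind zeta)) x * E (t - s) (F (ext zeta)) eta
  - E s (ind zeta) x * E (t - s) (L (F (ext zeta))) eta).
have dPhiE (s : R) : s \in `]0, t[%R -> is_derive s 1 Phi (dPhi s).
  rewrite in_itv/= => /andP[s0 st]; have ts0 : 0 < t - s by rewrite subr_gt0.
  apply: is_derive_bigsum => zeta.
  have dp := expect_derive HA x (dind zeta) s0.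
  have dg := expect_derive HA eta (d2 (ext zeta)) ts0.
  have dts : is_derive s 1 (fun u : R => t - u) (-1).
    have -> : (-1 : R) = 0 - 1 by rewrite sub0r.
    exact: is_deriveB.
  have dgt := @is_derive1_comp R (g zeta) (fun u => t - u) s _ _ dg dts.
  rewrite (_ : h zeta = p zeta * (g zeta \o (fun u => t - u)))//.
  apply: is_derive_eq (is_deriveM dp dgt) _.
  rewrite /= /p /g !max_r ?ltW// -[_ *: _]/(_ * _) -[X in _ + X]/(_ * _); ring.
have cp zeta : continuous (p zeta).
  exact: (@expect_continuous R n Lam w q _ _ P X HA M _ x (dind zeta)).
have cg zeta : continuous (g zeta).
  exact: (@expect_continuous R n Lam w q _ _ P X HA M _ eta (d2 (ext zeta))).
have cPhi : {within `[0, t], continuous Phi}.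
  apply: continuous_subspaceT => s; apply: continuous_bigsum => zeta.
  apply: continuousM; first exact: cp.
  apply: (@continuous_comp _ _ _ (fun u : R => t - u) (g zeta)); last exact: cg.
  by apply: continuousB; [exact: cst_continuous|exact: cvg_id].
have PhiT : Phi t = E t (F ^~ eta) x.
  rewrite /Phi [RHS](expect_decomp HM _ (ltW t0) (d1 eta)).
  apply: eq_bigr => zeta _; rewrite /h /p /g subrr maxxx (max_r (ltW t0)) mulrC.
  by rewrite (expect0 HA eta (d2 _)).
have Phi0 : Phi 0 = E t (F x) eta.
  transitivity (\sum_(zeta : local_state n M)
      E t (F (ext zeta)) eta * (restr M x == zeta)%:R).
    apply: eq_bigr => zeta _; rewrite /h /p /g subr0 maxxx (max_r (ltW t0)) mulrC.
    by rewrite (expect0 HA x (dind _)).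
  rewrite -(@depends_sum _ _ _ M (fun x => E t (F x) eta))//.
  by move=> a b e; congr (E t _ eta); apply/funext => zeta; exact: d1.
have [c] := MVT t0 dPhiE cPhi; rewrite in_itv/= => /andP[c0 ct].
rewrite PhiT Phi0 subr0 => ->; rewrite normrM (gtr0_norm t0) ler_pM2r//.
pose u := t - c; have u0 : 0 <= u by rewrite subr_ge0 ltW.
(* The derivative regrouped: given the dual state [xi], it is the primal expectation of the
   difference of the two generators, which [hF] bounds pointwise. *)
pose H xi := E u (fun zeta => L (F ^~ zeta) xi - L (F xi) zeta) eta.
have dL1 zeta : depends_on M.+2 (L (F ^~ zeta)) by exact: depends_on_generator.
have dL2 xi : depends_on M.+2 (L (F xi)) by exact: depends_on_generator.
have dLi zeta : depends_on M.+2 (L (ind zeta)) by exact: depends_on_generator.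
have dL1' xi : depends_on M (fun zeta => L (F ^~ zeta) xi).
  move=> a b e; congr (L _ xi); apply/funext => xi'; exact: d2.
have dL2' zeta : depends_on M (fun xi => L (F xi) zeta).
  by move=> a b e; congr (L _ zeta); apply/funext => xi'; exact: d1.
have dE1 : depends_on M.+2 (fun xi => E u (fun zeta => L (F ^~ zeta) xi) eta).
  by move=> a b e; congr (E u _ eta); apply/funext => zeta; exact: dL1.
have dE2 : depends_on M (fun xi => E u (L (F xi)) eta).
  by move=> a b e; congr (E u _ eta); apply/funext => zeta; exact: dL2'.
have dE3 : depends_on M (fun xi => E u (F xi) eta).
  by move=> a b e; congr (E u _ eta); apply/funext => zeta; exact: d1.
have -> : dPhi c = E c H x.
  rewrite /dPhi sumrB.
  transitivity (E c (fun xi => E u (fun zeta => L (F ^~ zeta) xi) eta) x -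
                E c (fun xi => E u (L (F xi)) eta) x).
    congr (_ - _).
      transitivity (E c (fun xi => L (fun xi' => \sum_zeta
          E u (F (ext zeta)) eta * ind zeta xi') xi) x).
        rewrite [RHS](_ : _ = E c (fun xi => \sum_zeta
          E u (F (ext zeta)) eta * L (ind zeta) xi) x); last first.
          congr (E c _ x); apply/funext => xi; exact: (generator_sum _ _ _ dind).
        rewrite (expect_sum HM (M := M.+2) _ _ (ltW c0)); last first.
          by move=> zeta a b e; rewrite (dLi zeta _ _ e).
        apply: eq_bigr => zeta _; rewrite (expectZ HM (M := M.+2) _ _ (ltW c0)).
          by rewrite mulrC.
        exact: dLi.
      congr (E c _ x); apply/funext => xi.
      rewrite -(generator_expect _ _ u0 d1 d2); congr (L _ xi); apply/funext => xi'.
      by rewrite -(@depends_sum _ _ _ M (fun x => E u (F x) eta)).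
    rewrite (expect_decomp HM _ (ltW c0) dE2).
    by apply: eq_bigr => zeta _; rewrite mulrC.
  rewrite -(expectB HM (M := M.+2) _ (ltW c0))//; last first.
    by apply: depends_onS dE2; lia.
  congr (E c _ x); apply/funext => xi; rewrite /H (expectB HM (M := M.+2))//.
  by apply: depends_onS (dL1' xi); lia.
have dH xi : depends_on M.+2 (fun zeta => L (F ^~ zeta) xi - L (F xi) zeta).
  move=> a b e; rewrite (dL2 xi a b e); congr (_ - _).
  by apply: (depends_onS _ (dL1' xi)) e; lia.
have dH' : depends_on M.+2 H.
  by move=> a b e; congr (E u _ eta); apply/funext => zeta; rewrite (dL1 _ _ _ e);
    congr (_ - _); apply: (depends_onS _ (dL2' zeta)) e; lia.
have EH xi : `|H xi| <= h1 xi + E u h2 eta.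
  have lek k : depends_on M.+2 k -> (forall zeta, k zeta <= h1 xi + h2 zeta) ->
      E u k eta <= h1 xi + E u h2 eta.
    move=> dk kh; rewrite -{1}(expect_cst P X u (h1 xi) eta).
    rewrite -(expectD HM _ u0 (@depends_on_cst _ _ _ M' _) dh2).
    apply: (le_expect HM (M := maxn M.+2 M')) => //.
      exact: depends_onS (leq_maxl _ _) dk.
    by move=> a b e; rewrite (depends_onS (leq_maxr _ _) dh2 e).
  rewrite ler_norml; apply/andP; split; last first.
    by apply: lek => // zeta; apply: le_trans (hF _ _); rewrite ler_norm.
  rewrite lerNl -mulN1r -(expectZ HM _ _ u0 (dH xi)); apply: lek.
    by move=> a b e; rewrite (dH _ _ _ e).
  move=> zeta; rewrite mulN1r; apply: le_trans (hF xi zeta).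
  by rewrite -normrN ler_norm.
have le k : depends_on M.+2 k -> (forall xi, k xi <= h1 xi + E u h2 eta) ->
    E c k x <= B1 + B2.
  move=> dk kh; apply: (@le_trans _ _ (E c h1 x + E u h2 eta)); last first.
    apply: lerD; [apply: hB1|apply: hB2] => //; try exact: ltW.
    by rewrite /u gerBl ltW.
  rewrite -(expect_cst P X c (E u h2 eta) x).
  rewrite -(expectD HM _ (ltW c0) dh1 (@depends_on_cst _ _ _ M' _)).
  apply: (le_expect HM (M := maxn M.+2 M')) => //.
  - exact: ltW.
  - exact: depends_onS (leq_maxl _ _) dk.
  - by move=> a b e; rewrite (depends_onS (leq_maxr _ _) dh1 e).
rewrite ler_norml; apply/andP; split; last first.
  by apply: le => // xi; apply: le_trans (EH _); rewrite ler_norm.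
rewrite lerNl -mulN1r -(expectZ HM _ _ (ltW c0) dH'); apply: le.
  by move=> a b e; rewrite (dH' _ _ e).
move=> xi; rewrite mulN1r; apply: le_trans (EH xi).
by rewrite -normrN ler_norm.
Qed.

End DualityGap.

(** * The duality function of a finite window *)

Section WindowDuality.
Context {R : realType} (n : nat) (Q : R).
Hypothesis Q0 : 0 < Q.
Implicit Types (a b c e : 'I_n.+1) (s : seq ('I_n.+1 * 'I_n.+1)).

Definition hole_factor a c : R := if (c < a)%N then Q^-1 ^+ 2 else 1.

(* A pair holds the dual and the primal value at a site; every particle is
   weighted by the sites listed before it. *)
Fixpoint window_dual s : R :=
  if s is p :: s' then
    (p.1 <= p.2)%N%:R * \prod_(p' <- s') hole_factor p'.1 p.2 * window_dual s'
  else 1.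

Definition particle_count s := count (fun p => p.1 != ord0) s.

(** The jump rate divided by [w], for a pair in the order of listing; with [Q] equal to [q^-1] it is
    the rate of a bond read from right to left. *)
Definition exchange_rate a b : R :=
  if a == b then 0 else if (b < a)%N then Q else Q^-1.

Lemma hole_factor0 c : hole_factor ord0 c = 1.
Proof. by []. Qed.

Lemma hole_factor_max a : hole_factor a ord_max = 1.
Proof. by rewrite /hole_factor ltnNge leq_ord. Qed.

Lemma window_dual_cat s1 s2 : window_dual (s1 ++ s2) =
  window_dual s1 * (\prod_(p <- s1) \prod_(p' <- s2) hole_factor p'.1 p.2) *
  window_dual s2.
Proof.
elim: s1 => [|p s1 IH] /=; first by rewrite big_nil !mul1r.
rewrite IH big_cat big_cons /=; ring.
Qed.

(** The factors linking the two sites to [s1] and [s2] are unchanged by either exchange, so a case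
    analysis on the order of four values remains. It explains the weight [Q^-1 ^+ 2]: for a lone
    particle, [b = ord0] and [c < a <= e], the dual jump contributes [Q * Q^-1 ^+ 2] and the primal
    exchange [Q^-1]. *)
Lemma window_dual_swap s1 s2 a b c e :
  exchange_rate a b * (window_dual (s1 ++ [:: (b, c), (a, e) & s2]) -
                       window_dual (s1 ++ [:: (a, c), (b, e) & s2])) =
  exchange_rate c e * (window_dual (s1 ++ [:: (a, e), (b, c) & s2]) -
                       window_dual (s1 ++ [:: (a, c), (b, e) & s2])).
Proof.
have split a' b' c' e' : window_dual (s1 ++ [:: (a', c'), (b', e') & s2]) =
    window_dual s1 * window_dual s2 *
    (\prod_(p <- s1) \prod_(p' <- s2) hole_factor p'.1 p.2) *
    ((\prod_(p <- s1) hole_factor a' p.2) * (\prod_(p <- s1) hole_factor b' p.2)) *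
    ((\prod_(p <- s2) hole_factor p.1 c') * (\prod_(p <- s2) hole_factor p.1 e')) *
    ((a' <= c')%N%:R * (b' <= e')%N%:R * hole_factor b' c').
  rewrite window_dual_cat /= big_cons /=.
  under eq_bigr do rewrite !big_cons /= mulrA.
  rewrite !big_split /=; ring.
rewrite !split.
rewrite [(\prod_(p <- s1) _) * _ in X in X * _ * _ - _]mulrC.
rewrite [(\prod_(p <- s2) hole_factor p.1 e) * _]mulrC -!mulrBr.
rewrite mulrCA [RHS]mulrCA; congr (_ * _).
rewrite /hole_factor /exchange_rate -!val_eqE /=.
have Qn0 : Q != 0 by rewrite gt_eqF.
case: (ltngtP a b) => ab; case: (ltngtP c e) => ce;
  case: (leqP a c) => ac; case: (leqP b e) => be; try (exfalso; lia);
  case: (leqP b c) => bc; case: (leqP a e) => ae; try (exfalso; lia);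
  rewrite /= ?(mulr0n, mulr1n); try ring; try by field.
Qed.

(** The site listed last precedes no particle, so when it holds none its primal value does not
    enter. This is why defects matter near one end of the window only. *)
Lemma window_dual_rcons0 s c : window_dual (rcons s (ord0, c)) = window_dual s.
Proof.
rewrite -cats1 window_dual_cat /= big_nil !mulr1 big1 ?mulr1// => p _.
by rewrite big_seq1.
Qed.

Lemma window_dual_full s : window_dual ((ord0, ord_max) :: s) = window_dual s.
Proof. by rewrite /= mul1r big1 ?mul1r// => p _; rewrite hole_factor_max. Qed.

Lemma hole_factor_ge0 a c : 0 <= hole_factor a c.
Proof. by rewrite /hole_factor; case: ifP => // _; rewrite exprn_ge0// invr_ge0 ltW. Qed.

Lemma window_dual_ge0 s : 0 <= window_dual s.
Proof.
elim: s => //= p s IH; rewrite !mulr_ge0//.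
by apply: prodr_ge0 => p' _; exact: hole_factor_ge0.
Qed.

(** Each site weighs every later particle by at most [q ^+ 2]. The parameter is free: taking it to
    be 1 when [Q^-1 <= 1] yields the bound 1 used for [D_plus]. *)
Lemma window_dual_le (q : R) s : 1 <= q -> Q^-1 <= q ->
  window_dual s <= (q ^+ 2) ^+ (size s * particle_count s).
Proof.
move=> q1 Qq; have q21 : 1 <= q ^+ 2 by rewrite exprn_ege1.
elim: s => //= p s IH; rewrite -mulrA.
have h : \prod_(p' <- s) hole_factor p'.1 p.2 <= (q ^+ 2) ^+ particle_count s.
  elim: s {IH} => [|p' s IH]; first by rewrite big_nil.
  rewrite big_cons /= exprD; apply: ler_pM => //; first exact: hole_factor_ge0.
    by apply: prodr_ge0 => x _; exact: hole_factor_ge0.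
  have [->|_] := eqVneq p'.1 ord0; first by rewrite expr0.
  rewrite expr1 /hole_factor; case: ifP => // _.
  by rewrite lerXn2r// ?nnegrE ?invr_ge0 ?ltW// (lt_le_trans _ q1).
apply: (@le_trans _ _ (1 * ((q ^+ 2) ^+ particle_count s *
    (q ^+ 2) ^+ (size s * particle_count s)))).
  apply: ler_pM => //; first last.
  - apply: ler_pM => //; last exact: window_dual_ge0.
    by apply: prodr_ge0 => x _; exact: hole_factor_ge0.
  - by case: (_ <= _)%N.
  - rewrite mulr_ge0 ?window_dual_ge0//.
    by apply: prodr_ge0 => x _; exact: hole_factor_ge0.
rewrite mul1r -exprD ler_weXn2l//.
by rewrite -mulSn leq_mul// leq_addl.
Qed.

End WindowDuality.

(** * Windows of two configurations and their boundary errors *)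

Section ConfigurationWindow.
Context {R : realType} (n : nat) (Lam : pred int) (w q : R) (b : bool).
Implicit Types (xi eta : config n Lam) (z : int) (M N : nat).

(* [b = true] is the case of [D_plus]. The function [D_minus] is its mirror image
   with [q] replaced by [1/q], so the window is then listed from right to left. *)
Definition directed_rate : R := if b then q else q^-1.
Local Notation Q := directed_rate.

Definition directed_range M := if b then zrange M else rev (zrange M).

Definition window_pairs M xi eta :=
  [seq (hat ord0 xi z, hat ord_max eta z) | z <- directed_range M].

(* The indicator of [N] particles keeps the function bounded, and it is invariant
   under exchanges inside the window. *)
Definition window_duality N M xi eta : R :=
  window_dual Q (window_pairs M xi eta) *
  (particle_count (window_pairs M xi eta) == N)%:R.

Local Notation G := window_duality.

Lemma mem_directed_range M z : (z \in directed_range M) = (absz z <= M)%N.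
Proof. by rewrite /directed_range; case: b; rewrite ?mem_rev mem_zrange. Qed.

(* The end of the window beyond which the defects of [eta] are counted. *)
Definition sensitive_end M : int := if b then - M%:Z else M%:Z.

Lemma directed_rangeS M : directed_range M.+1 =
  sensitive_end M.+1 :: rcons (directed_range M) (- sensitive_end M.+1).
Proof.
rewrite /directed_range /sensitive_end zrangeS; case: b; first by rewrite opprK.
by rewrite rev_cons rev_rcons rcons_cons.
Qed.

Lemma window_pairsS M xi eta : window_pairs M.+1 xi eta =
  (hat ord0 xi (sensitive_end M.+1), hat ord_max eta (sensitive_end M.+1)) ::
  rcons (window_pairs M xi eta)
    (hat ord0 xi (- sensitive_end M.+1), hat ord_max eta (- sensitive_end M.+1)).
Proof. by rewrite /window_pairs directed_rangeS /= map_rcons. Qed.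

Lemma directed_range_split M z : - M%:Z <= z < M%:Z -> exists s1 s2,
  directed_range M = s1 ++ [:: if b then z else z + 1, if b then z + 1 else z & s2].
Proof.
move=> zM; have [s1 [s2 e]] := zrange_split zM.
rewrite /directed_range; case: b; first by exists s1, s2.
exists (rev s2), (rev s1); rewrite e rev_cat !rev_cons.
by rewrite -!cats1 -!catA.
Qed.

Lemma directed_range_uniq M : uniq (directed_range M).
Proof. by rewrite /directed_range; case: b; rewrite ?rev_uniq zrange_uniq. Qed.

Lemma window_pairs_depends M : (forall eta, depends_on M (window_pairs M ^~ eta)) /\
  (forall xi, depends_on M (window_pairs M xi)).
Proof.
split=> zeta a c e; apply/eq_in_map => z; rewrite mem_directed_range => zM.
  by rewrite (depends_on_hat ord0 zM e).
by rewrite (depends_on_hat ord_max zM e).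
Qed.

Lemma window_duality_depends N M : (forall eta, depends_on M (G N M ^~ eta)) /\
  (forall xi, depends_on M (G N M xi)).
Proof.
have [h1 h2] := window_pairs_depends M.
split=> zeta a c e; rewrite /G; first by rewrite (h1 zeta a c e).
by rewrite (h2 zeta a c e).
Qed.

Lemma window_duality_insensitive N M xi eta eta' :
  hat ord0 xi (- sensitive_end M.+1) = ord0 ->
  (forall z, (absz z <= M.+1)%N -> z != - sensitive_end M.+1 ->
     hat ord_max eta z = hat ord_max eta' z) ->
  G N M.+1 xi eta = G N M.+1 xi eta'.
Proof.
move=> xi0 e; rewrite /G !window_pairsS xi0 -!rcons_cons !window_dual_rcons0.
rewrite /particle_count -!cats1 !count_cat /=.
have se : absz (sensitive_end M.+1) = M.+1 by rewrite /sensitive_end; case: b; lia.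
have -> : window_pairs M xi eta' = window_pairs M xi eta.
  apply/eq_in_map => z; rewrite mem_directed_range => zM; rewrite e//; first lia.
  by apply/eqP; lia.
by rewrite (e (sensitive_end M.+1)) //; [rewrite se|apply/eqP; lia].
Qed.

Hypotheses (hw : 0 < w) (hq : 1 <= q).

Let q0 : 0 < q. Proof. exact: lt_le_trans hq. Qed.

Lemma directed_rate_gt0 : 0 < Q.
Proof. by rewrite /directed_rate; case: b; rewrite ?invr_gt0. Qed.

(** Transfers [window_dual_swap] to a bond of the lattice, with [u] and [v] its ends in the order of
    listing. *)
Lemma window_duality_interior N M z xi eta : - M%:Z <= z < M%:Z ->
  bond_term w q (G N M ^~ eta) z xi = bond_term w q (G N M xi) z eta.
Proof.
move=> zM; rewrite /bond_term /bond_rate.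
case bz : (bond_at Lam z) => [[k l]|]; last by rewrite !mul0r.
have [/= b1 b2] := bond_at_val bz.
have [s1 [s2 es]] := directed_range_split zM.
have := directed_range_uniq M; rewrite es cat_uniq /= => /and3P[_ s1z /and3P[]].
rewrite inE negb_or => /andP[_ s2u] s2v _; move: s1z; rewrite !negb_or.
set u := if b then z else z + 1 in es s2u s2v *.
set v := if b then z + 1 else z in es s2u s2v *.
case/and3P => s1u s1v _.
have out c (zeta : config n Lam) (s : seq int) : u \notin s -> v \notin s ->
    {in s, hat c (swap z zeta) =1 hat c zeta}.
  move=> su sv y ys; rewrite (hat_swap _ _ _ bz).
  have yu : y != u by apply: contraNneq su => <-.
  have yv : y != v by apply: contraNneq sv => <-.
  by move: yu yv; rewrite /u /v; case: b => /negPf-> /negPf->.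
have su c (zeta : config n Lam) : hat c (swap z zeta) u = hat c zeta v.
  rewrite /u /v; case: b; rewrite (hat_swap _ _ _ bz) eqxx//.
  by rewrite ifN//; apply/eqP; lia.
have sv c (zeta : config n Lam) : hat c (swap z zeta) v = hat c zeta u.
  rewrite /u /v; case: b; rewrite (hat_swap _ _ _ bz) eqxx//.
  by rewrite ifN//; apply/eqP; lia.
(* Reading a bond from right to left reverses the comparison of its values and so interchanges the
   rates [q] and [q^-1]; passing from [q] to [Q] compensates for this. *)
have rE c (zeta : config n Lam) :
    rate w q zeta k l = w * exchange_rate Q (hat c zeta u) (hat c zeta v).
  have hz : hat c zeta z = zeta k by rewrite -b1 hat_val.
  have hz1 : hat c zeta (z + 1) = zeta l by rewrite -b2 hat_val.
  rewrite rateE /exchange_rate /directed_rate /u /v; case: b; rewrite hz hz1.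
    by case: ifP => _; rewrite ?mulr0.
  rewrite eq_sym invrK; case: ifPn => e; first by rewrite mulr0.
  by case: ltngtP => // /val_inj ee; rewrite ee eqxx in e.
rewrite (rE ord0 xi) (rE ord_max eta) -!mulrA; congr (_ * _).
have pairsE xi' eta' : window_pairs M xi' eta' =
   [seq (hat ord0 xi' z, hat ord_max eta' z) | z <- s1] ++
   [:: (hat ord0 xi' u, hat ord_max eta' u), (hat ord0 xi' v, hat ord_max eta' v) &
   [seq (hat ord0 xi' z, hat ord_max eta' z) | z <- s2]].
  by rewrite /window_pairs es map_cat.
have p1E (s : seq int) : u \notin s -> v \notin s ->
  [seq (hat ord0 (swap z xi) z0, hat ord_max eta z0) | z0 <- s] =
  [seq (hat ord0 xi z0, hat ord_max eta z0) | z0 <- s].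
  by move=> h1 h2; apply/eq_in_map => y ys; rewrite (out _ _ s).
have p2E (s : seq int) : u \notin s -> v \notin s ->
  [seq (hat ord0 xi z0, hat ord_max (swap z eta) z0) | z0 <- s] =
  [seq (hat ord0 xi z0, hat ord_max eta z0) | z0 <- s].
  by move=> h1 h2; apply/eq_in_map => y ys; rewrite (out _ _ s).
rewrite /G !pairsE !su !sv !p1E// !p2E//.
rewrite /particle_count !count_cat /= [((hat ord0 xi v != ord0) + _)%N]addnCA.
by rewrite -!mulrBl !mulrA window_dual_swap// directed_rate_gt0.
Qed.

Lemma size_window_pairs M xi eta : size (window_pairs M xi eta) = M.*2.+1.
Proof.
rewrite size_map /directed_range; case: b; rewrite ?size_rev;
by rewrite size_map size_iota.
Qed.

Definition window_bound N M : R := (q ^+ 2) ^+ (M.*2.+1 * N).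

Lemma window_duality_bounds N M xi eta : 0 <= G N M xi eta <= window_bound N M.
Proof.
rewrite /G; apply/andP; split.
  by rewrite mulr_ge0// window_dual_ge0// directed_rate_gt0.
case: eqP => [<-|_]; last by rewrite mulr0 !exprn_ge0// ltW.
rewrite mulr1 /window_bound -(size_window_pairs M xi eta).
apply: window_dual_le => //; first exact: directed_rate_gt0.
rewrite /directed_rate; case: b; rewrite ?invrK//.
by apply: le_trans hq; rewrite invf_le1.
Qed.

Definition sensitive_bond M : int := if b then - M.+1%:Z else M%:Z.

Definition particle_error M xi : R :=
  \sum_(z <- [:: - M.+1%:Z; - M.+1%:Z + 1; M%:Z; M%:Z + 1])
    (hat ord0 xi z != ord0)%:R.

Definition defect_error M eta : R :=
  \sum_(z <- [:: sensitive_bond M; sensitive_bond M + 1])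
    (hat ord_max eta z != ord_max)%:R.

(** Equal values make the exchange trivial, unequal ones cannot both be [c], and two values of [f]
    differ by at most [B]. *)
Lemma bond_term_le (f : config n Lam -> R) c B z xi :
  (forall eta, 0 <= f eta <= B) -> `|bond_term w q f z xi| <=
  w * q * B * ((hat c xi z != c)%:R + (hat c xi (z + 1) != c)%:R).
Proof.
move=> fB; have B0 : 0 <= B by have /andP[] := fB xi; exact: le_trans.
rewrite /bond_term; have [e|ne] := eqVneq (hat c xi z) (hat c xi (z + 1)).
  by rewrite (swap_id e) subrr mulr0 normr0 !mulr_ge0// ltW.
have /andP[r0 r1] := bond_rate_bounds hw hq z xi.
rewrite normrM (ger0_norm r0) -mulrA; apply: ler_pM => //.
apply: (@le_trans _ _ B).
  have /andP[f0 f1] := fB xi; have /andP[g0 g1] := fB (swap z xi).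
  by rewrite ler_norml; apply/andP; split; lra.
rewrite ler_peMr//; case: eqP => [e|_]; last by rewrite lerDl.
by rewrite add0r; rewrite e eq_sym in ne; rewrite ne.
Qed.

(** Interior bonds cancel. Of the two boundary bonds, acting on [xi] both need a particle at one of
    their ends; acting on [eta], the sensitive one needs a defect, while at the opposite end [eta]
    is felt only through a dual particle on the last listed site. That site is therefore charged
    twice, whence the factor 2. *)
Lemma generator_gap N M xi eta :
  `|generator w q (G N M.+1 ^~ eta) xi - generator w q (G N M.+1 xi) eta| <=
  w * q * window_bound N M.+1 * 2 * particle_error M.+1 xi +
  w * q * window_bound N M.+1 * defect_error M.+1 eta.
Proof.
have [d1 d2] := window_duality_depends N M.+1.
rewrite (depends_generatorE _ _ _ (d1 eta)) (depends_generatorE _ _ _ (d2 xi)).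
set K := w * q * window_bound N M.+1.
have K0 : 0 <= K by rewrite /K !mulr_ge0 ?ltW// !exprn_gt0.
have int z : - M.+1%:Z <= z < M.+1%:Z ->
    bond_term w q (G N M.+1 ^~ eta) z xi - bond_term w q (G N M.+1 xi) z eta = 0.
  by move=> zM; rewrite window_duality_interior ?subrr.
(* The list of left ends supplied by [depends_generatorE] is symmetric, so its rightmost entry gives
   a bond wholly outside the window. *)
have top : bond_term w q (G N M.+1 ^~ eta) M.+2%:Z xi -
    bond_term w q (G N M.+1 xi) M.+2%:Z eta = 0.
  rewrite /bond_term (depends_on_swapN xi (d1 eta)); last lia.
  by rewrite (depends_on_swapN eta (d2 xi)) ?subrr ?mulr0 ?subrr//; lia.
rewrite -sumrB zrangeS big_cons big_rcons /= top addr0 zrangeS big_cons big_rcons /=.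
rewrite (int (- M.+1%:Z)) ?add0r; last lia.
rewrite big_seq big1 ?add0r; last by move=> z; rewrite mem_zrange => zM; apply: int; lia.
have x1 := bond_term_le ord0 (- M.+2%:Z) xi (window_duality_bounds N M.+1 ^~ eta).
have x2 := bond_term_le ord0 M.+1%:Z xi (window_duality_bounds N M.+1 ^~ eta).
have e1 := bond_term_le ord_max (- M.+2%:Z) eta (window_duality_bounds N M.+1 xi).
have e2 := bond_term_le ord_max M.+1%:Z eta (window_duality_bounds N M.+1 xi).
have ins z : z = (if b then M.+1%:Z else - M.+2%:Z) ->
    `|bond_term w q (G N M.+1 xi) z eta| <=
    K * (hat ord0 xi (- sensitive_end M.+1) != ord0)%:R.
  move=> ez; have [x0|x0] := eqVneq (hat ord0 xi (- sensitive_end M.+1)) ord0.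
    rewrite /bond_term (@window_duality_insensitive N M xi (swap z eta) eta)//.
      by rewrite subrr mulr0 normr0 mulr0.
    move=> y yM ye; case bz : (bond_at Lam z) => [k|]; last by rewrite /swap bz.
    rewrite (hat_swap _ _ _ bz); move: ez ye; rewrite /sensitive_end.
    by case: b => -> /eqP ye; rewrite ifN ?ifN//; apply/eqP; lia.
  rewrite /= mulr1 /bond_term normrM /K; have /andP[r0 r1] := bond_rate_bounds hw hq z eta.
  rewrite (ger0_norm r0); apply: ler_pM => //.
  have /andP[f0 f1] := window_duality_bounds N M.+1 xi eta.
  have /andP[g0 g1] := window_duality_bounds N M.+1 xi (swap z eta).
  by rewrite ler_norml; apply/andP; split; lra.
rewrite /particle_error /defect_error !big_cons !big_nil !addr0.
rewrite /sensitive_bond; rewrite /sensitive_end in ins.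
have -> : - M.+2%:Z + 1 = - M.+1%:Z by lia.
rewrite (_ : - M.+2%:Z + 1 = - M.+1%:Z) in x1 e1; last lia.
move: x1 x2 e1 e2; rewrite -/K.
move: (ins M.+1%:Z) (ins (- M.+2%:Z)) => {ins top int}.
move: (bond_term w q _ _ xi) (bond_term w q _ _ xi) => b1 b2.
move: (bond_term w q _ _ eta) (bond_term w q _ _ eta) => b3 b4.
have Kn (p : bool) : 0 <= K * p%:R by rewrite mulr_ge0.
have nle (x1 x2 x3 x4 : R) : `|x1 - x2 + (x3 - x4)| <= `|x1| + `|x2| + (`|x3| + `|x4|).
  by apply: le_trans (ler_normD _ _) _; apply: lerD; exact: ler_normB.
move=> i1 i2 x1 x2 e1 e2; apply: le_trans (nle _ _ _ _) _.
have E1 : - M.+2%:Z + 1 = - M.+1%:Z by lia.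
move: i1 i2 e1 e2.
move: (Kn (hat ord0 xi (- M.+2%:Z) != ord0)) (Kn (hat ord0 xi (- M.+1%:Z) != ord0))
      (Kn (hat ord0 xi M.+1%:Z != ord0)) (Kn (hat ord0 xi (M.+1%:Z + 1) != ord0)).
case: b => k1 k2 k3 k4; rewrite ?opprK ?E1.
  by move=> /(_ erefl) i1 _ e1 e2; lra.
by move=> _ /(_ erefl) i2 e1 e2; lra.
Qed.

End ConfigurationWindow.

(** * Particle lists and configurations *)

Section ParticleCount.
Context (n : nat) (Lam : pred int).
Implicit Types (xi eta : config n Lam) (x y : particles n Lam) (M N : nat).

Definition pcount M xi := count (fun z => hat ord0 xi z != ord0) (zrange M).

Lemma particle_count_window b M xi eta :
  particle_count (window_pairs b M xi eta) = pcount M xi.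
Proof.
rewrite /particle_count count_map /pcount /directed_range; case: b => //=.
by rewrite count_rev.
Qed.

Lemma pcountS M xi : pcount M.+1 xi =
  ((hat ord0 xi (- M.+1%:Z)%R != ord0) + (pcount M xi + (hat ord0 xi M.+1%:Z != ord0)))%N.
Proof.
rewrite /pcount zrangeS; move: (zrange M) => s.
by rewrite /= -cats1 count_cat /= addn0.
Qed.

Lemma leq_pcount M M' xi : (M <= M')%N -> (pcount M xi <= pcount M' xi)%N.
Proof.
move/subnK => <-; elim: (M' - M)%N => // k IH.
by rewrite addSn pcountS (leq_trans IH)// addnCA leq_addr.
Qed.

Lemma pcount_depends M : depends_on M (@pcount M).
Proof.
move=> xi eta e; apply: eq_in_count => z; rewrite mem_zrange => zM.
by rewrite (depends_on_hat ord0 zM e).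
Qed.

Lemma pcount_out M M' xi z : (M < absz z)%N -> (absz z <= M')%N ->
  hat ord0 xi z != ord0 -> (pcount M xi < pcount M' xi)%N.
Proof.
have key k : (M <= k)%N -> (pcount M xi <= pcount k xi)%N by exact: leq_pcount.
case: z => [[|k]|k] //= Mk kM' hz; apply: leq_trans (leq_pcount _ kM');
  have := key k Mk; rewrite pcountS; first by rewrite hz; lia.
by rewrite -NegzE hz; lia.
Qed.

Definition sites M : seq (site Lam) :=
  pmap (insub : int -> option (site Lam)) (zrange M).

Lemma mem_sites M k : (k \in sites M) = (absz (val k) <= M)%N.
Proof.
rewrite -mem_zrange mem_pmap; apply/mapP/idP => [[z zM e]|kM].
  by case: insubP e => // k' _ ez [->]; have -> : val k' = z by exact: ez.
by exists (val k); rewrite ?valK.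
Qed.

Lemma sites_sorted M : sorted (fun k l : site Lam => val k < val l) (sites M).
Proof.
have := zrange_sorted M.
rewrite /sites; elim: (zrange M) => //= z s IH; rewrite path_sortedE; last first.
  by move=> a b c; exact: lt_trans.
case/andP => zs ss; case: insubP => [k _ ek|_]; last exact: IH.
rewrite /= path_sortedE; last by move=> a b c; exact: lt_trans.
rewrite IH// andbT; apply/allP => l; rewrite mem_pmap => /mapP[y ys].
case: insubP => // l' _ el [->]; have := allP zs y ys.
have -> : val k = z by exact: ek.
by have -> : val l' = y by exact: el.
Qed.

Lemma sites_uniq M : uniq (sites M).
Proof. by apply: pmap_sub_uniq; exact: zrange_uniq. Qed.

Definition occupied M xi : seq (site Lam * 'I_n.+1) :=
  [seq (k, xi k) | k <- sites M & xi k != ord0].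

Lemma occupied_particles M xi :
  sorted (fun u v : site Lam * 'I_n.+1 => val u.1 < val v.1) (occupied M xi) &&
  all (fun u => u.2 != ord0) (occupied M xi).
Proof.
apply/andP; split.
  rewrite /occupied sorted_map; apply: sorted_filter; last exact: sites_sorted.
  by move=> a b c; exact: lt_trans.
by rewrite all_map; apply/allP => k; rewrite mem_filter => /andP[].
Qed.

(** On particle lists within the window this inverts [occupation]; in general it forgets the
    particles outside. *)
Definition occupied_part M xi : particles n Lam :=
  exist (fun s : seq (site Lam * 'I_n.+1) =>
    sorted (fun u v => val u.1 < val v.1) s && all (fun u => u.2 != ord0) s)
  (occupied M xi) (occupied_particles M xi).

Lemma occupation_part M xi k :
  occupation (occupied_part M xi) k = if (absz (val k) <= M)%N then xi k else ord0.
Proof.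
rewrite /occupation /= /occupied /unzip1 /unzip2 -!map_comp.
set s := [seq k <- sites M | xi k != ord0].
have -> : [seq (fst \o (fun k => (k, xi k))) i | i <- s] = s by exact: map_id.
have [ks|ks] := boolP (k \in s).
  rewrite (nth_map k) ?index_mem// nth_index//=.
  by move: ks; rewrite mem_filter mem_sites => /andP[_ ->].
rewrite nth_default ?size_map; last by rewrite memNindex.
move: ks; rewrite mem_filter mem_sites negb_and negbK.
by case: leqP => //= _; rewrite orbF => /eqP.
Qed.

Lemma occupation_out y k : k \notin unzip1 (val y) -> occupation y k = ord0.
Proof.
by move=> ky; rewrite /occupation nth_default// size_map memNindex// size_map.
Qed.

Lemma particles_uniq y : uniq (unzip1 (val y)).
Proof.
have /andP[h _] := valP y.
apply: (@sorted_uniq _ (fun k l : site Lam => val k < val l)).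
- by move=> a b c; exact: lt_trans.
- by move=> a; rewrite ltxx.
- by rewrite /unzip1 sorted_map.
Qed.

Lemma occupation_in y u : u \in val y -> occupation y u.1 = u.2.
Proof.
move=> uy; rewrite /occupation; have uy1 : u.1 \in unzip1 (val y) by exact: map_f.
set i := index _ _; have i_s : (i < size (val y))%N.
  by rewrite -[size _](size_map fst) index_mem.
rewrite (nth_map u)//.
have e : nth u.1 (unzip1 (val y)) i = u.1 by exact: nth_index.
have : nth u (val y) (index u (val y)) = u by exact: nth_index.
have ui : (index u (val y) < size (unzip1 (val y)))%N by rewrite size_map index_mem.
move=> e2; suff -> : i = index u (val y) by rewrite e2.
apply/eqP; rewrite -(nth_uniq u.1 _ ui (particles_uniq y)) ?size_map//.
by rewrite e (nth_map u) ?index_mem// e2.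
Qed.

Lemma occupation_neq0 y k : (occupation y k != ord0) = (k \in unzip1 (val y)).
Proof.
apply/idP/idP; first by apply: contraNT => /occupation_out ->.
case/mapP => u uy ->; rewrite occupation_in//.
by have /andP[_ /allP/(_ u uy)] := valP y.
Qed.

(** The sites of a list are the nonzero sites of its configuration in their unique increasing order,
    and the species are the values there. *)
Lemma occupation_inj : injective (@occupation n Lam).
Proof.
move=> x y e; apply: val_inj.
have um (s : particles n Lam) : val s = [seq (k, occupation s k) | k <- unzip1 (val s)].
  rewrite -map_comp -[LHS]map_id; apply/eq_in_map => u us /=.
  by rewrite occupation_in//; case: u {us}.
rewrite (um x) (um y) e; congr map.
have srt (s : particles n Lam) : sorted (fun k l : site Lam => val k < val l) (unzip1 (val s)).
  by have /andP[h _] := valP s; rewrite /unzip1 sorted_map.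
apply: (irr_sorted_eq _ _ (srt x) (srt y)).
- by move=> a b c; exact: lt_trans.
- by move=> a; rewrite ltxx.
- by move=> k; rewrite -!occupation_neq0 e.
Qed.

Definition within M y := all (fun u => absz (val u.1) <= M)%N (val y).

Lemma within_le M M' y : (M <= M')%N -> within M y -> within M' y.
Proof. by move=> MM'; apply: sub_all => u /leq_trans; apply. Qed.

Lemma within_ex y : exists M, within M y.
Proof.
exists (\max_(u <- val y) absz (val u.1))%N; apply/allP => u uy.
exact: (@leq_bigmax_seq _ _ predT).
Qed.

Lemma occupation_within M y k : within M y -> (M < absz (val k))%N ->
  occupation y k = ord0.
Proof.
move=> yM Mk; apply: occupation_out; apply/mapP => -[u uy e].
by have := allP yM u uy; rewrite -e leqNgt Mk.
Qed.

Lemma hat_occupation_within M y z : within M y -> (M < absz z)%N ->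
  hat ord0 (occupation y) z = ord0.
Proof.
move=> yM Mz; have [Lz|Lz] := boolP (Lam z); last by rewrite hat_out.
by rewrite -[z]/(val (exist _ z Lz : site Lam)) hat_val (occupation_within yM).
Qed.

Lemma pcount_sites M xi : pcount M xi = count (fun k => xi k != ord0) (sites M).
Proof.
rewrite /pcount /sites; elim: (zrange M) => //= z s IH.
by rewrite IH /hat; case: insub.
Qed.

Lemma pcount_occupation M y : within M y -> pcount M (occupation y) = size (val y).
Proof.
move=> yM; rewrite pcount_sites -size_filter -(size_map fst).
apply: perm_size; apply: uniq_perm.
- by rewrite filter_uniq// sites_uniq.
- exact: particles_uniq.
move=> k; rewrite mem_filter mem_sites occupation_neq0; apply: andb_idr.
by case/mapP => u uy ->; exact: (allP yM).
Qed.

Lemma size_occupied_part M xi : size (val (occupied_part M xi)) = pcount M xi.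
Proof. by rewrite size_map size_filter -pcount_sites. Qed.

Lemma within_occupied_part M xi : within M (occupied_part M xi).
Proof.
apply/allP => u /= /mapP[k]; rewrite mem_filter mem_sites => /andP[_ kM] ->.
exact: kM.
Qed.

Lemma occupied_part_occupation M y : within M y ->
  occupied_part M (occupation y) = y.
Proof.
move=> yM; apply: occupation_inj; apply/funext => k; rewrite occupation_part.
by case: leqP => // kM; rewrite (occupation_within yM).
Qed.

Lemma occupied_part_depends M : depends_on M (occupied_part M).
Proof.
move=> xi eta e; apply: occupation_inj; apply/funext => k.
by rewrite !occupation_part; case: ifP => // kM; exact: e.
Qed.

(** A particle outside the window would raise the count in some larger window. *)
Lemma occupation_of_pcount M xi : (forall M', (pcount M' xi <= pcount M xi)%N) ->
  occupation (occupied_part M xi) = xi.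
Proof.
move=> h; apply/funext => k; rewrite occupation_part; case: leqP => // kM.
apply/esym/eqP; apply: contraT => xk.
have := h (absz (val k)); rewrite leqNgt (@pcount_out _ _ _ (val k))//.
by rewrite hat_val.
Qed.

End ParticleCount.

(** * Boundary effects vanish *)

Section GapBound.
Context {R : realType} (w q t : R) (r N : nat).

Definition tail_bound (j : nat) : R := (2 * w * q * t) ^+ j / j`!%:R.

(** The 10 collects the boundary terms of [generator_gap]: four sites with weight 2 for dual
    particles and two sites with weight 1 for defects. The factor [t] is the length of the time
    interval. *)
Definition gap_bound j : R :=
  10 * w * q * t * window_bound q N (r + j).+1 * tail_bound j.

(** The window has [2 * r + 3 + 2 * j] sites, so its bound is geometric in [j] and is absorbed into
    the argument of the exponential series. *)
Lemma window_tailE j : window_bound q N (r + j).+1 * tail_bound j =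
  (q ^+ 2) ^+ ((r.*2 + 3) * N) *
  exp_coeff (2 * w * q * t * (q ^+ 2) ^+ (2 * N)) j.
Proof.
rewrite /tail_bound /window_bound /exp_coeff /=.
rewrite (_ : ((r + j).+1.*2.+1 * N = (r.*2 + 3) * N + 2 * N * j)%N); last lia.
rewrite exprD (exprM _ (2 * N)%N j) (exprMn j (2 * w * q * t)).
move: ((q ^+ 2) ^+ ((r.*2 + 3) * N)) (((q ^+ 2) ^+ (2 * N)) ^+ j) => A B.
by move: ((2 * w * q * t) ^+ j) => D; ring.
Qed.

Lemma gap_bound_cvg : gap_bound @ \oo --> 0.
Proof.
pose C := 10 * w * q * t * (q ^+ 2) ^+ ((r.*2 + 3) * N).
pose K := 2 * w * q * t * (q ^+ 2) ^+ (2 * N).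
rewrite (_ : gap_bound = fun j => C * exp_coeff K j); last first.
  by apply/funext => j; rewrite /gap_bound -mulrA window_tailE mulrA.
rewrite -(mulr0 C); apply: cvgMr.
exact: cvg_series_cvg_0 (is_cvg_series_exp_coeff K).
Qed.

End GapBound.

Section Asymptotics.
Context {R : realType} (n : nat) (Lam : pred int) (w q : R) (b : bool).
Hypotheses (hw : 0 < w) (hq : 1 <= q).
Context (d : measure_display) (Omega : measurableType d).
Variables (P : config n Lam -> probability Omega R).
Variables (X : R -> Omega -> config n Lam).
Hypothesis HA : is_priority_asep P X w q.
Variables (x : particles n Lam) (eta : config n Lam) (t : R) (r N : nat).
Hypothesis t0 : 0 <= t.
Hypothesis hx : within r x.
Hypothesis heta : forall z, r%:Z < (if b then - z else z) -> hat ord_max eta z = ord_max.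

Local Notation E := (semigroup P X).
Local Notation G := (window_duality q b).
Local Notation win j := (r + j).+1.
Local Notation tail_bound := (tail_bound w q t).
Local Notation gap_bound := (gap_bound w q t r N).
Let HM : is_markov P X. Proof. by case: HA. Qed.

Let q0 : 0 < q. Proof. exact: lt_le_trans hq. Qed.

Lemma tail_bound_ge s j : 0 <= s -> s <= t ->
  (2 * w * q * s) ^+ j / j`!%:R <= tail_bound j.
Proof.
move=> s0 st; rewrite ler_pM2r ?invr_gt0 ?ltr0n ?fact_gt0//.
by rewrite lerXn2r// ?nnegrE ?ler_wpM2l ?mulr_ge0 ?(ltW q0) ?(ltW hw).
Qed.

Lemma dual_particle_tail j z s : 0 <= s -> s <= t -> (win j <= absz z)%N ->
  E s (fun xi => (hat ord0 xi z != ord0)%:R) (occupation x) <= tail_bound j.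
Proof.
move=> s0 st zj; apply: le_trans (tail_bound_ge j s0 st).
pose e : int := if 0 <= z then 1 else -1.
have ez : e * z = absz z by rewrite /e; case: ifP => h; lia.
apply: (expect_occupied hw hq HA (e := e) (r := r.+1)) => //.
- by rewrite /e; case: ifP.
- move=> y; rewrite /e => h; apply: (hat_occupation_within hx).
  by move: h; case: ifP => h; lia.
- by rewrite ez; lia.
Qed.

Lemma defect_tail j z s : 0 <= s -> s <= t -> (win j)%:Z <= (if b then - z else z) ->
  E s (fun xi => (hat ord_max xi z != ord_max)%:R) eta <= tail_bound j.
Proof.
move=> s0 st zj; apply: le_trans (tail_bound_ge j s0 st).
pose e : int := if b then -1 else 1.
apply: (expect_occupied hw hq HA (e := e) (r := r.+1)) => //.
- by rewrite /e; case: b.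
- by move=> y h; apply: heta; move: h; rewrite /e; case: b => h; lia.
- by move: zj; rewrite /e; case: b => h; lia.
Qed.

Lemma depends_on_sum_hat M c (s : seq int) : all (fun z => absz z <= M)%N s ->
  depends_on M (fun xi : config n Lam => \sum_(z <- s) (hat c xi z != c)%:R : R).
Proof.
move=> /allP sM xi xi' e; apply: eq_big_seq => z /sM zM.
by rewrite (depends_on_hat c zM e).
Qed.

Lemma expect_sum_hat c (s : seq int) (u C : R) xi : 0 <= u ->
  (forall z, z \in s -> E u (fun eta => (hat c eta z != c)%:R) xi <= C) ->
  E u (fun eta => \sum_(z <- s) (hat c eta z != c)%:R) xi <= (size s)%:R * C.
Proof.
move=> u0; elim: s => [|z s IH] h.
  rewrite mul0r (_ : (fun _ => _) = fun=> 0) ?expect_cst//.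
  by apply/funext => eta'; rewrite big_nil.
pose M := maxn (absz z) (\max_(y <- s) absz y)%N.
rewrite (_ : (fun _ => _) = fun eta => (hat c eta z != c)%:R +
    \sum_(z <- s) (hat c eta z != c)%:R); last first.
  by apply/funext => eta'; rewrite big_cons.
have d1 : depends_on M (fun eta : config n Lam => (hat c eta z != c)%:R : R).
  by apply: (depends_on_hat1 c (fun a => (a != c)%:R)); rewrite leq_maxl.
have d2 : depends_on M (fun xi : config n Lam => \sum_(z <- s) (hat c xi z != c)%:R : R).
  apply: depends_on_sum_hat; apply/allP => y ys; rewrite leq_max.
  by rewrite (@leq_bigmax_seq _ _ predT (fun y : int => absz y) y ys) ?orbT.
rewrite (expectD HM _ u0 d1 d2) /= -natr1 addrC mulrDl mul1r.
apply: lerD; first by apply: IH => y ys; apply: h; rewrite inE ys orbT.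
by apply: h; rewrite mem_head.
Qed.

Lemma expect_particle_error j s : 0 <= s -> s <= t ->
  E s (particle_error (win j)) (occupation x) <= 4 * tail_bound j.
Proof.
move=> s0 st; apply: (expect_sum_hat s0) => z; rewrite !inE => zz.
by apply: dual_particle_tail => //; case/or4P: zz => /eqP ->; lia.
Qed.

Lemma expect_defect_error j s : 0 <= s -> s <= t ->
  E s (defect_error b (win j)) eta <= 2 * tail_bound j.
Proof.
move=> s0 st; apply: (expect_sum_hat s0) => z; rewrite !inE => zz.
by apply: defect_tail => //; move: zz; rewrite /sensitive_bond; case: b => /orP[]/eqP ->; lia.
Qed.

Lemma tail_bound_ge0 j : 0 <= tail_bound j.
Proof.
by rewrite /tail_bound divr_ge0// exprn_ge0// !mulr_ge0// ltW.
Qed.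

Lemma duality_gap_le j :
  `|E t (G N (win j) ^~ eta) (occupation x) - E t (G N (win j) (occupation x)) eta|
  <= gap_bound j.
Proof.
have [d1 d2] := window_duality_depends n Lam q b N (win j).
set K := w * q * window_bound q N (win j).
have K0 : 0 <= K by rewrite /K !mulr_ge0 ?ltW// exprn_gt0// exprn_gt0.
have K20 : 0 <= K * 2 by apply: mulr_ge0.
have dxe : depends_on (win j).+2 (@particle_error R n Lam (win j)).
  by apply: depends_on_sum_hat => /=; lia.
have dee : depends_on (win j).+2 (@defect_error R n Lam b (win j)).
  by apply: depends_on_sum_hat; rewrite /= /sensitive_bond; case: b; lia.
apply: le_trans (duality_gap HA (M := win j) (M' := (win j).+2)
  (h1 := fun xi => K * 2 * particle_error (win j) xi)
  (h2 := fun eta => K * defect_error b (win j) eta)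
  (B1 := K * 2 * (4 * tail_bound j)) (B2 := K * (2 * tail_bound j))
  t0 d1 d2 _ _ _ _ _) _.
- by move=> a c e; rewrite (dxe _ _ e).
- by move=> a c e; rewrite (dee _ _ e).
- by move=> xi zeta; apply: generator_gap.
- move=> s s0 st; rewrite (expectZ HM _ _ s0 dxe) ler_wpM2l//.
  exact: expect_particle_error.
- move=> s s0 st; rewrite (expectZ HM _ _ s0 dee) ler_wpM2l//.
  exact: expect_defect_error.
- by rewrite /gap_bound /K le_eqVlt; apply/orP; left; apply/eqP; ring.
Qed.

End Asymptotics.

(** * Conservation of the number of particles *)

Section LawOfDual.
Context {R : realType} (n : nat) (Lam : pred int) (w q : R).
Hypotheses (hw : 0 < w) (hq : 1 <= q).
Context (d : measure_display) (Omega : measurableType d).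
Variables (P : config n Lam -> probability Omega R).
Variables (X : R -> Omega -> config n Lam).
Hypothesis HA : is_priority_asep P X w q.
Variables (x : particles n Lam) (t : R) (r : nat).
Hypothesis t0 : 0 <= t.
Hypothesis hx : within r x.

Local Notation E := (semigroup P X).
Local Notation win j := (r + j).+1.
Let HM : is_markov P X. Proof. by case: HA. Qed.
Let q0 : 0 < q. Proof. exact: lt_le_trans hq. Qed.
Local Notation N := (size (val x)).
Local Notation Px := (P (occupation x)).

(* Against the full configuration, which is invariant, the window function
   reduces to the indicator of [N] particles. *)
Lemma count_gap_le j :
  `|E t (fun xi => (pcount (win j) xi == N)%:R) (occupation x) -
    (pcount (win j) (occupation x) == N)%:R| <= gap_bound w q t r N j.
Proof.
pose full : config n Lam := fun=> ord_max.
have full_hat z : hat ord_max full z = ord_max by rewrite /hat; case: insub.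
have Gfull xi : window_duality q true N (win j) xi full = (pcount (win j) xi == N)%:R.
  rewrite /window_duality particle_count_window /window_pairs.
  rewrite (_ : window_dual _ _ = 1) ?mul1r//.
  elim: directed_range => //= z s ->; rewrite full_hat leq_ord mul1r mulr1.
  by apply: big1 => p _; rewrite hole_factor_max.
have [d1 d2] := window_duality_depends n Lam q true N (win j).
set K := w * q * window_bound q N (win j).
have K0 : 0 <= K by rewrite /K !mulr_ge0 ?ltW// exprn_gt0// exprn_gt0.
have K20 : 0 <= K * 2 by apply: mulr_ge0.
have dxe : depends_on (win j).+2 (@particle_error R n Lam (win j)).
  by apply: depends_on_sum_hat => /=; lia.
have gen (c : R) zeta : generator w q (fun _ : config n Lam => c) zeta = 0.
  by rewrite (@generatorE _ _ _ _ _ _ [::])// big_nil.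
have genF xi : generator w q (window_duality q true N (win j) xi) full = 0.
  rewrite (depends_generatorE _ _ _ (d2 xi)) big1// => z _; rewrite /bond_term.
  by rewrite (@swap_id _ _ ord_max) ?full_hat// subrr mulr0.
have -> : (fun xi => (pcount (win j) xi == N)%:R) =
    (fun xi => (fun _ : config n Lam => window_duality q true N (win j) xi full) full).
  by apply/funext => xi; rewrite Gfull.
rewrite -Gfull -[X in _ - X](expect_cst P X t _ full).
apply: le_trans (duality_gap HA (M := win j) (M' := (win j).+2)
  (F := fun xi _ => window_duality q true N (win j) xi full)
  (h1 := fun xi => K * 2 * particle_error (win j) xi) (h2 := fun=> 0)
  (B1 := K * 2 * (4 * tail_bound w q t j)) (B2 := 0) t0 _ _ _ _ _ _ _) _ => //.
- by move=> a c e; rewrite (dxe _ _ e).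
(* Every exchange leaves [full] fixed, so the primal generator vanishes there and [generator_gap],
   free of its defect term, bounds the dual generator alone. *)
- move=> xi zeta; rewrite addr0 gen subr0.
  rewrite -[X in `|X|]subr0 -(genF xi).
  apply: le_trans (generator_gap _ _ _ _ _ _ _) _ => //.
  rewrite -/K [X in _ + X](_ : _ = 0) ?addr0//.
  by rewrite /defect_error big1 ?mulr0// => z _; rewrite full_hat eqxx.
- move=> s s0 st; rewrite (expectZ HM _ _ s0 dxe) ler_wpM2l//.
  exact: (expect_particle_error hw hq HA t0 hx).
- by move=> s _ _; rewrite expect_cst.
- have e1 : 0 <= K * tail_bound w q t j * t.
    by apply: mulr_ge0 => //; apply: mulr_ge0 => //; exact: (tail_bound_ge0 hw hq t0).
  rewrite /gap_bound.
  have -> : 10 * w * q * t * window_bound q N (win j) * tail_bound w q t j =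
      10 * (K * tail_bound w q t j * t).
    by rewrite /K; ring.
  by rewrite addr0; lra.
Qed.

Lemma expect_bool M (p : config n Lam -> bool) xi : depends_on M p ->
  (E t (fun eta => (p eta)%:R) xi)%:E = P xi [set omega | p (X t omega)].
Proof.
move=> dp; have mp := state_measurable HM (fun a : bool => is_true a) t0 dp.
rewrite /semigroup /Rintegral fineK; last first.
  have dR : depends_on M (fun eta => (p eta)%:R : R) by move=> a c e; rewrite (dp _ _ e).
  exact: (integrable_fin_num measurableT (state_integrable HM xi t0 dR)).
rewrite (eq_integral (EFin \o \1_[set omega | p (X t omega)])).
  by rewrite integral_indic ?setIT.
by move=> omega _ /=; rewrite indicE; congr (_%:R%:E); congr nat_of_bool;
  apply/idP/idP; rewrite inE.
Qed.

Lemma prob_count_neq j :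
  (Px [set omega | pcount (win j) (X t omega) != N] <= (gap_bound w q t r N j)%:E)%E.
Proof.
have dp : depends_on (win j) (fun xi : config n Lam => pcount (win j) xi == N).
  by move=> a c e; rewrite (pcount_depends e).
have dpn : depends_on (win j) (fun xi : config n Lam => pcount (win j) xi != N).
  by move=> a c e; rewrite (pcount_depends e).
have dR : depends_on (win j) (fun xi : config n Lam => (pcount (win j) xi == N)%:R : R).
  by move=> a c e; rewrite (pcount_depends e).
rewrite -(expect_bool _ dpn) lee_fin.
rewrite (_ : (fun _ => _) = fun xi => 1 - (pcount (win j) xi == N)%:R); last first.
  by apply/funext => xi; case: eqP => _; rewrite ?subrr ?subr0.
rewrite (expectB HM _ t0 (@depends_on_cst _ _ _ (win j) _) dR) expect_cst.
have := count_gap_le j.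
rewrite pcount_occupation; last by apply: within_le hx; lia.
by rewrite eqxx distrC; apply: le_trans; rewrite ler_norm.
Qed.

(** The event is contained in miscount events whose probabilities are bounded by [gap_bound], which
    tends to 0. *)
Lemma null_of_count (A : set Omega) M : measurable A ->
  (forall M', (M <= M')%N -> A `<=` [set omega | pcount M' (X t omega) != N]) ->
  Px A = 0%E.
Proof.
move=> mA hA; apply/eqP; rewrite eq_le measure_ge0 andbT.
have cv : (gap_bound w q t r N j)%:E @[j --> \oo] --> 0%E.
  by apply: cvg_EFin; [exact: nearW|exact: gap_bound_cvg].
rewrite -(cvg_lim _ cv)//; apply: lime_ge; first by apply: cvgP cv.
near=> j; apply: le_trans (prob_count_neq j); apply: le_measure; rewrite ?inE//.
  by apply: (state_measurable HM (fun c : nat => is_true (c != N)) t0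
    (@pcount_depends _ _ (win j))).
by apply: hA; rewrite leqW// (leq_trans _ (leq_addl _ _))//; near: j; exact: nbhs_infty_ge.
Unshelve. all: by end_near. Qed.

Lemma prob_count_gt M : Px [set omega | (N < pcount M (X t omega))%N] = 0%E.
Proof.
apply: (null_of_count (M := M)).
  exact: (state_measurable HM (fun c : nat => is_true (N < c)%N) t0 (@pcount_depends _ _ M)).
move=> M' MM' omega /= h; rewrite gtn_eqF//.
exact: leq_trans h (leq_pcount _ MM').
Qed.

Lemma prob_size_neq y : size (val y) != N ->
  Px [set omega | X t omega = occupation y] = 0%E.
Proof.
move=> yN; have [M yM] := within_ex y; apply: (null_of_count (M := M)).
  by have := point_measurable HA (occupation y) t0.
move=> M' MM' omega /= ->; rewrite pcount_occupation//.
exact: within_le yM.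
Qed.

(** The first condition discards local states with a nonzero value at a position off the lattice,
    where [restr] always reads [ord0]. *)
Definition valid_state M (zeta : local_state n M) :=
  (restr M (ext zeta : config n Lam) == zeta) && (pcount M (ext zeta : config n Lam) == N).

Definition state_particles M (zeta : local_state n M) : particles n Lam :=
  occupied_part M (ext zeta).

Lemma restr_occupied_part M (xi : config n Lam) :
  restr M (occupation (occupied_part M xi)) = restr M xi.
Proof.
by apply: depends_on_restr => k kM; rewrite occupation_part kM.
Qed.

Lemma state_particles_inj M :
  {in @valid_state M &, injective (@state_particles M)}.
Proof.
move=> z1 z2 /andP[/eqP e1 _] /andP[/eqP e2 _] e.
by rewrite -e1 -e2 -restr_occupied_part -[in RHS]restr_occupied_part -!/(state_particles _) e.
Qed.

(** If the window shows [N] particles and no window shows more, nothing lies outside: off the null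
    set [Z] the local state determines the configuration. *)
Lemma prob_valid_state M (zeta : local_state n M) : valid_state zeta ->
  Px [set omega | restr M (X t omega) = zeta] =
  Px [set omega | X t omega = occupation (state_particles zeta)].
Proof.
case/andP => /eqP e1 /eqP e2.
have m1 : measurable [set omega | restr M (X t omega) = zeta].
  exact: (state_measurable HM [set zeta] t0 (@depends_on_restr n Lam M)).
have m2 := point_measurable HA (occupation (state_particles zeta)) t0.
pose Z := \bigcup_M' [set omega | (N < pcount M' (X t omega))%N].
have mZ M' : measurable [set omega | (N < pcount M' (X t omega))%N].
  exact: (state_measurable HM (fun c : nat => is_true (N < c)%N) t0 (@pcount_depends _ _ M')).
apply/eqP; rewrite eq_le; apply/andP; split; last first.
  apply: le_measure; rewrite ?inE// => omega /= ->.
  by rewrite restr_occupied_part.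
have : (Px ([set omega | X t omega = occupation (state_particles zeta)] `|` Z) <=
    Px [set omega | X t omega = occupation (state_particles zeta)] + Px Z)%E.
  by apply: measureU2 => //; exact: bigcup_measurable.
rewrite [X in (_ + X)%E](_ : _ = 0%E) ?adde0; last first.
  apply: measure_negligible; first exact: bigcup_measurable.
  by apply: negligible_bigcup => M'; apply/negligibleP => //; exact: prob_count_gt.
apply: le_trans; apply: le_measure; rewrite ?inE//.
  by apply: measurableU => //; exact: bigcup_measurable.
move=> omega /= e.
have [h|] := pselect (forall M', (pcount M' (X t omega) <= N)%N); last first.
  by move=> /existsNP[M' /negP]; rewrite -ltnNge => h; right; exists M'.
left; have er : ext zeta = ext (restr M (X t omega)) :> config n Lam by rewrite e.
have pe : pcount M (X t omega) = N.
  by rewrite -e2 er (depends_ext _ (@pcount_depends n Lam M)).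
rewrite /state_particles er (depends_ext _ (@occupied_part_depends n Lam M)).
by rewrite occupation_of_pcount// => M'; rewrite pe.
Qed.

End LawOfDual.

Section DualSum.
Context {R : realType} (n : nat) (Lam : pred int) (w q : R) (b : bool).
Hypotheses (hw : 0 < w) (hq : 1 <= q).
Context (d : measure_display) (Omega : measurableType d).
Variables (P : config n Lam -> probability Omega R).
Variables (X : R -> Omega -> config n Lam).
Hypothesis HA : is_priority_asep P X w q.
Variables (x : particles n Lam) (eta : config n Lam) (t : R) (r : nat).
Hypothesis t0 : 0 <= t.
Hypothesis hx : within r x.
Hypothesis heta : forall z, r%:Z < (if b then - z else z) -> hat ord_max eta z = ord_max.

Local Notation E := (semigroup P X).
Local Notation win j := (r + j).+1.
Local Notation G := (window_duality q b).
Let HM : is_markov P X. Proof. by case: HA. Qed.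
Local Notation N := (size (val x)).
Local Notation Px := (P (occupation x)).

Variable D : particles n Lam -> \bar R.
Hypothesis D_ge0 : forall y, (0 <= D y)%E.
Hypothesis D_window : forall y j, within (win j) y -> size (val y) = N ->
  D y = (G N (win j) (occupation y) eta)%:E.

Local Notation F := (fun y => (D y * Px [set omega | X t omega = occupation y])%E).

Definition window_particles j : set (particles n Lam) :=
  @state_particles n Lam (win j) @` [set` @valid_state n Lam x (win j)].

Lemma window_particlesP j y :
  window_particles j y <-> within (win j) y /\ size (val y) = N.
Proof.
split=> [[zeta /andP[/eqP e1 /eqP e2] <-]|[yw yN]].
  by split; [exact: within_occupied_part|rewrite size_occupied_part].
exists (restr (win j) (occupation y)).
  apply/andP; rewrite (depends_ext _ (@depends_on_restr n Lam _)) eqxx.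
  by rewrite (depends_ext _ (@pcount_depends n Lam _)) pcount_occupation// yN.
rewrite /state_particles (depends_ext _ (@occupied_part_depends n Lam _)).
exact: occupied_part_occupation.
Qed.

(** Local states that are not valid drop out: a value off the lattice has probability zero, and a
    wrong number of particles makes [G] vanish. *)
Lemma expect_window_particles j :
  (E t (G N (win j) ^~ eta) (occupation x))%:E =
  (\sum_(y \in window_particles j) F y)%E.
Proof.
have [d1 d2] := window_duality_depends n Lam q b N (win j).
rewrite (expect_decomp HM _ t0 (d1 eta)) -sumEFin fsbig_image; last first.
  by move=> z1 z2; rewrite !inE => v1 v2; exact: (@state_particles_inj n Lam x).
rewrite -(bigfs _ (index_enum_uniq _)); last by move=> i; rewrite mem_index_enum.
rewrite [RHS]big_mkcond; apply: eq_bigr => zeta _.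
have out : restr (win j) (ext zeta : config n Lam) != zeta ->
    E t (fun xi => (restr (win j) xi == zeta)%:R) (occupation x) = 0.
  move=> ne; rewrite (_ : (fun _ => _) = fun=> 0) ?expect_cst//; apply/funext => xi.
  case: eqP => // e; move: ne; rewrite -{1}e => /eqP; case.
  by rewrite (depends_ext _ (@depends_on_restr n Lam _)).
case: ifPn => [v|]; last first.
  rewrite negb_and => /orP[/out ->|ne]; first by rewrite mulr0.
  by rewrite /window_duality particle_count_window (negPf ne) mulr0 mul0r.
have vs := prob_valid_state hw hq HA t0 hx v.
have [yw yN] : within (win j) (state_particles Lam zeta) /\
    size (val (state_particles Lam zeta)) = N.
  by apply/window_particlesP; exists zeta.
rewrite (D_window yw yN) -vs EFinM (expect_indic HM)// fineK; last first.
  by rewrite fin_num_measure//; exact: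
    (state_measurable HM [set zeta] t0 (@depends_on_restr n Lam (win j))).
congr (_%:E * _)%E; apply: (d1 eta) => k kj.
by rewrite occupation_part kj.
Qed.

(** A squeeze. A finite set of particle lists fits into a large window once the lists of the wrong
    length, which have probability zero, are removed; conversely each window supplies a finite set.
    The window sums tend to [l] because the duality gap tends to 0. *)
Lemma dual_sum (l : R) :
  E t (G N (win j) (occupation x)) eta @[j --> \oo] --> l ->
  (\esum_(y in [set: particles n Lam]) F y = l%:E)%E.
Proof.
move=> cl.
have F0 y : (0 <= F y)%E by rewrite mule_ge0.
have cv : E t (G N (win j) ^~ eta) (occupation x) @[j --> \oo] --> l.
  pose gap j := E t (G N (win j) ^~ eta) (occupation x) -
    E t (G N (win j) (occupation x)) eta.
  have cg : gap j @[j --> \oo] --> 0.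
    apply/cvgr0Pnorm_le => e e0; have /cvgr0Pnorm_le/(_ e e0) := gap_bound_cvg w q t r N.
    apply: filterS => j h; apply: le_trans (duality_gap_le hw hq HA N t0 hx heta j) _.
    by apply: le_trans h; exact: ler_norm.
  rewrite -(add0r l); apply: cvg_trans (cvgD cg cl).
  by apply: near_eq_cvg; near=> j; rewrite /gap /= subrK.
have cvE : (E t (G N (win j) ^~ eta) (occupation x))%:E @[j --> \oo] --> l%:E.
  by apply: cvg_EFin => //; exact: nearW.
apply/eqP; rewrite eq_le; apply/andP; split.
  apply: ge_ereal_sup => _ [Y [finY _]] <-.
  rewrite -(cvg_lim _ cvE)//; apply: lime_ge; first by apply: cvgP cvE.
  have [M YM] : exists M, forall y, Y y -> within M y.
    move: finY => /finite_seqP[s ->]; elim: s => [|y s [M IH]]; first by exists 0%N.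
    have [M' yM'] := within_ex y; exists (maxn M M') => y' /=.
    rewrite inE => /orP[/eqP ->|/IH]; first exact: within_le (leq_maxr _ _) yM'.
    exact: within_le (leq_maxl _ _).
  near=> j; rewrite expect_window_particles.
  rewrite -(fsbig_widen (Y `&` [set y | size (val y) = N]) Y); last 2 first.
  - by move=> y [].
  - move=> y [Yy /not_andP[//|/eqP yN]] /=.
    by rewrite (prob_size_neq hw hq HA t0 hx yN) mule0.
  apply: lee_fsum_nneg_subset => //.
  - exact: finite_setIl.
  - exact: finite_image.
  - move=> y; rewrite !inE => -[Yy yN]; apply/window_particlesP; split=> //.
    apply: within_le (YM _ Yy); rewrite leqW// (leq_trans _ (leq_addl _ _))//.
    by near: j; exact: nbhs_infty_ge.
rewrite -(cvg_lim _ cvE)//; apply: lime_le; first by apply: cvgP cvE.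
apply: nearW => j; rewrite expect_window_particles; apply: esum_ge.
exists (window_particles j) => //; split => //.
exact: finite_image.
Unshelve. all: by end_near. Qed.

End DualSum.

(** * Duality functions as limits of window functions *)

Section ExtendedLimits.
Context {R : realType}.
Local Open Scope ereal_scope.

Lemma cvg_expeR (u : R^nat) (l : \bar R) :
  (u i)%:E @[i --> \oo] --> l -> (expR (u i))%:E @[i --> \oo] --> expeR l.
Proof.
case: l => [l| |] ul.
- apply: cvg_EFin; first exact: nearW.
  apply: (@cvg_comp _ _ _ u expR); last exact: continuous_expR.
  by have /fine_cvgP[_] := ul.
- apply/cvgeyPge => A; have /cvgeyPge/(_ A) := ul.
  apply: filterS => i; rewrite !lee_fin => /le_trans; apply.
  by apply: le_trans (expR_ge1Dx _); rewrite lerDr.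
- apply: cvg_EFin; first exact: nearW.
  apply/cvgr0Pnorm_le => e e0; have /cvgeNyPle/(_ (ln e)) := ul.
  apply: filterS => i; rewrite lee_fin => h.
  by rewrite ger0_norm ?expR_ge0// -[leRHS]lnK ?posrE// ler_expR.
Qed.

(** The alternative excludes an indeterminate product of 0 and [+oo]. Each of its branches passes to
    partial products, hence the strengthened induction. *)
Lemma cvg_prode (I : Type) (s : seq I) (f : I -> R^nat) (l : I -> \bar R) :
  (forall i, (f i j)%:E @[j --> \oo] --> l i) ->
  (forall i, l i \is a fin_num) \/ (forall i, 1 <= l i) ->
  (\prod_(i <- s) f i j)%R%:E @[j --> \oo] --> \prod_(i <- s) l i.
Proof.
move=> fl H; suff [] : (\prod_(i <- s) f i j)%R%:E @[j --> \oo] --> \prod_(i <- s) l i /\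
  ((\prod_(i <- s) l i \is a fin_num /\ (forall i, l i \is a fin_num)) \/
   (1 <= \prod_(i <- s) l i /\ forall i, 1 <= l i)) by [].
elim: s => [|i s [IH1 IH2]].
  rewrite big_nil; split.
    by under eq_fun do rewrite big_nil; exact: cvg_cst.
  by case: H => H; [left|right].
rewrite big_cons; split.
  under eq_fun do rewrite big_cons EFinM.
  apply: cvgeM => //; case: IH2 => [[h1 h2]|[h1 h2]]; first exact: mule_def_fin.
  have p0 z : 1 <= z -> 0 < z :> \bar R by apply: lt_le_trans; exact: lte01.
  by rewrite mule_defE (gt_eqF (p0 _ h1)) (gt_eqF (p0 _ (h2 i))).
case: IH2 => [[h1 h2]|[h1 h2]]; [left|right]; split => //; first exact: fin_numM.
by rewrite -[leLHS]mule1; apply: lee_pmul.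
Qed.

End ExtendedLimits.

Section DualLimit.
Context {R : realType} (n : nat) (Lam : pred int) (q : R) (b : bool).
Hypothesis hq : 1 <= q.
Implicit Types (x y : particles n Lam) (eta : config n Lam).

Local Notation G := (window_duality q b).
Local Notation Q := (directed_rate q b).

Definition before (y z : int) : bool := if b then y < z else z < y.

(** Convertible to [D_plus] for [b = true] and to [D_minus] for [b = false], so that both share one
    proof. *)
Definition duality_function x eta : \bar R :=
  (\prod_(u <- val x)
     (qpow q ((if b then - 2%R else 2%R)%:E *
        deficit u.2 [set l | before (val l) (val u.1)] eta)
      * (m u.2 u.1 eta)%:E))%E.

Lemma before_trans : transitive before.
Proof.
rewrite /before => a c e; case: b => h1 h2; first exact: lt_trans h1 h2.
exact: lt_trans h2 h1.
Qed.

Lemma directed_range_sorted M : sorted before (directed_range b M).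
Proof.
rewrite /directed_range /before; case: b; first exact: zrange_sorted.
by rewrite rev_sorted; exact: zrange_sorted.
Qed.

(** Regroups the factors: the recursion lets each site weigh the particles after it, whereas here
    each particle collects the sites before it, as in [duality_function]. *)
Lemma window_dual_sorted (f g : int -> 'I_n.+1) (s : seq int) : sorted before s ->
  window_dual Q [seq (f z, g z) | z <- s] =
  \prod_(z <- s) ((f z <= g z)%N%:R *
    \prod_(y <- s | before y z) hole_factor Q (f z) (g y)).
Proof.
elim: s => [|z s IH] /=; first by rewrite big_nil.
rewrite path_sortedE; last exact: before_trans.
case/andP => /allP zs /IH ->; rewrite big_cons big_map.
have bz : before z z = false by rewrite /before; case: b; rewrite ltxx.
have -> : \prod_(y <- z :: s | before y z) hole_factor Q (f z) (g y) = 1.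
  rewrite big1_seq// => y /andP[byz]; rewrite inE => /predU1P[yz|/zs bzy].
    by rewrite yz bz in byz.
  by have := before_trans byz bzy; rewrite /before; case: b; rewrite ltxx.
rewrite mulr1 -mulrA; congr (_ * _); rewrite -big_split /= [LHS]big_seq [RHS]big_seq.
apply: eq_bigr => y ys; rewrite big_cons zs// mulrCA; ring.
Qed.

Definition deficit_count M (u : site Lam * 'I_n.+1) eta : nat :=
  count (fun y : int => before y (val u.1) && (hat ord_max eta y < u.2)%N) (directed_range b M).

Lemma window_dual_particles M x eta : within M x ->
  window_dual Q (window_pairs b M (occupation x) eta) =
  \prod_(u <- val x) ((Q^-1 ^+ 2) ^+ deficit_count M u eta * m u.2 u.1 eta).
Proof.
move=> xM; rewrite /window_pairs window_dual_sorted ?directed_range_sorted//.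
rewrite (bigID (fun z => hat ord0 (occupation x) z != ord0)) /= [X in _ * X]big1 ?mulr1; last first.
  move=> z /negPn/eqP ->; rewrite mul1r; apply: big1 => y _; exact: hole_factor0.
rewrite -big_filter (perm_big [seq val k | k <- unzip1 (val x)]); last first.
  apply: uniq_perm.
  - by rewrite filter_uniq// directed_range_uniq.
  - by rewrite map_inj_uniq ?particles_uniq//; exact: val_inj.
  move=> z; rewrite mem_filter mem_directed_range; apply/andP/mapP.
    move=> [hz zM]; have [Lz|Lz] := boolP (Lam z); last by rewrite hat_out ?eqxx in hz.
    exists (exist _ z Lz : site Lam) => //; rewrite -occupation_neq0.
    by rewrite -(hat_val ord0).
  move=> [k kx ->]; rewrite hat_val occupation_neq0; split=> //.
  by case/mapP: kx => u ux ->; exact: (allP xM).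
rewrite big_map big_map big_seq [RHS]big_seq; apply: eq_bigr => u ux.
rewrite !hat_val occupation_in// mulrC; congr (_ * _).
rewrite /deficit_count /hole_factor -big_mkcondr.
by rewrite big_const_seq iter_mulr_1.
Qed.
Lemma count_sites M (p : pred int) : (forall z, ~~ Lam z -> p z = false) ->
  count p (zrange M) = count (fun k => p (val k)) (sites Lam M).
Proof.
move=> pL; rewrite /sites; elim: (zrange M) => //= z s ->.
case: insubP => [k _ ek|Lz]; last by rewrite pL.
by have -> : z = val k by [].
Qed.

(** The counts increase with the window, and their supremum is the extended sum because every finite
    set of sites lies in a window. Sites off the lattice read as full and are not counted. *)
Lemma deficit_cvg u eta : (deficit_count M u eta)%:R%:E @[M --> \oo] -->
  (deficit u.2 [set l | before (val l) (val u.1)] eta : \bar R).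
Proof.
pose A := [set l : site Lam | before (val l) (val u.1)].
pose F (l : site Lam) : \bar R := (1 - m u.2 l eta)%:E.
have F0 l : (0 <= F l)%E by rewrite lee_fin /m; case: (_ <= _)%N; rewrite ?subrr ?subr0.
pose XM M := [set` [pred l : site Lam | (l \in sites Lam M) && before (val l) (val u.1)]].
have XMP M l : XM M l = ((absz (val l) <= M)%N && before (val l) (val u.1)) :> Prop.
  by rewrite -mem_sites.
have cE M : (deficit_count M u eta)%:R%:E = (\sum_(l \in XM M) F l)%E.
  rewrite -(bigfs _ (sites_uniq Lam M)); last by move=> l /= /andP[->].
  rewrite sumEFin big_seq_cond /=.
  rewrite (eq_bigl (fun l => (l \in sites Lam M) && before (val l) (val u.1))); last first.
    by move=> l; rewrite andbA andbb.
  rewrite -big_seq_cond /deficit_count /directed_range.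
  have -> (p : pred int) : count p (if b then zrange M else rev (zrange M)) = count p (zrange M).
    by case: b; rewrite ?count_rev.
  rewrite count_sites; last by move=> z Lz; rewrite hat_out// ltnNge leq_ord andbF.
  congr (_%:E); elim: (sites Lam M) => [|l s IH]; first by rewrite big_nil.
  rewrite big_cons /= natrD IH hat_val; case: before => //=; rewrite ?add0r//.
  by rewrite /m ltnNge; case: (_ <= _)%N; rewrite ?subrr ?subr0.
have fin M : finite_set (XM M).
  by apply: (@sub_finite_set _ _ [set` sites Lam M]) => // l /= /andP[].
have nd : nondecreasing_seq (fun M => (deficit_count M u eta)%:R%:E : \bar R).
  move=> M M' MM'; rewrite !cE; apply: lee_fsum_nneg_subset => // l.
  by move=> /set_mem; rewrite XMP => /andP[lM lu]; apply/mem_set;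
      rewrite XMP lu (leq_trans lM).
rewrite [X in _ --> X](_ : _ = ereal_sup (range (fun M => (deficit_count M u eta)%:R%:E))).
  exact: ereal_nondecreasing_cvgn.
apply/eqP; rewrite eq_le; apply/andP; split.
  apply: ge_ereal_sup => _ [Y [finY YA]] <-.
  have [M YM] : exists M, forall l, Y l -> (absz (val l) <= M)%N.
    move: finY => /finite_seqP[s ->]; exists (\max_(l <- s) absz (val l))%N => l ls.
    exact: (@leq_bigmax_seq _ _ predT).
  apply: (@le_trans _ _ (\sum_(l \in XM M) F l)%E).
    apply: lee_fsum_nneg_subset => // l.
      by move=> /set_mem Yl; apply/mem_set; rewrite XMP YM//= YA.
    by move=> _; exact: F0.
  by rewrite -cE; apply: ereal_sup_ubound; exists M.
apply: ge_ereal_sup => _ [M _ <-]; rewrite cE; apply: esum_ge; exists (XM M) => //.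
by split=> // l; rewrite XMP => /andP[].
Qed.

Lemma directed_rate_pow k : (Q^-1 ^+ 2) ^+ k =
  expR (ln q * ((if b then - 2 else 2) * k%:R)) :> R.
Proof.
have q0 : 0 < q by apply: lt_le_trans hq.
have q2 : q ^+ 2 = expR (2 * ln q) by rewrite expRM_natl lnK.
rewrite (_ : Q^-1 ^+ 2 = expR ((if b then - 2 else 2) * ln q)).
  by rewrite -expRM_natr; congr expR; ring.
by rewrite /directed_rate; case: b; rewrite ?invrK// exprVn q2 mulNr expRN.
Qed.

Lemma window_dual_cvg x eta :
  (G (size (val x)) M (occupation x) eta)%:E @[M --> \oo] --> duality_function x eta.
Proof.
have [M0 xM0] := within_ex x.
pose f u M : R := (Q^-1 ^+ 2) ^+ deficit_count M u eta * m u.2 u.1 eta.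
apply: (@cvg_trans _ ((\prod_(u <- val x) f u M)%:E @[M --> \oo])).
  apply: near_eq_cvg; near=> M.
  have xM : within M x.
    by apply: within_le xM0; near: M; exact: nbhs_infty_ge.
  rewrite /G window_dual_particles// particle_count_window pcount_occupation//.
  by rewrite eqxx mulr1.
pose alive (u : site Lam * 'I_n.+1) := (u.2 <= eta u.1)%N.
(* A particle above a primal value lower than its species makes both sides 0, even next to an
   infinite power of [q]. Setting this case aside removes the products in which 0 and [+oo] could
   meet. *)
have [/allP am|/allPn[u ux um]] := boolP (all alive (val x)); last first.
  have -> : duality_function x eta = 0%E.
    rewrite /duality_function (big_rem u)//= /m (negPf (um : ~~ (u.2 <= eta u.1)%N)) mule0 mul0e//.
  apply: cvg_near_cst; apply: nearW => M.
  by rewrite (big_rem u)//= /f /m (negPf (um : ~~ (u.2 <= eta u.1)%N)) mulr0 mul0r.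
pose L (u : site Lam * 'I_n.+1) : \bar R := qpow q ((if b then - 2%R else 2%R)%:E *
  deficit u.2 [set l | before (val l) (val u.1)] eta)%E.
have -> : duality_function x eta = (\prod_(u <- val x) L u)%E.
  by apply: eq_big_seq => u /am ux; rewrite /m -/(alive u) ux mule1.
have fE M : \prod_(u <- val x) f u M =
    \prod_(u <- val x) (Q^-1 ^+ 2) ^+ deficit_count M u eta.
  by apply: eq_big_seq => u /am ux; rewrite /f /m -/(alive u) ux mulr1.
under eq_fun do rewrite fE.
have d0 (u : site Lam * 'I_n.+1) :
    (0 <= deficit u.2 [set l | before (val l) (val u.1)] eta :> \bar R)%E.
  by apply: esum_ge0 => l _; rewrite lee_fin /m; case: (_ <= _)%N; rewrite ?subrr ?subr0.
have lnq : 0 <= ln q by rewrite ln_ge0.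
apply: cvg_prode.
  move=> u; under eq_fun do rewrite directed_rate_pow.
  apply: cvg_expeR; under eq_fun do rewrite EFinM EFinM.
  by apply: cvgeZl => //; apply: cvgeZl => //; exact: deficit_cvg.
(* The remaining factors are at most 1, hence finite, for [b = true], and at least 1 for
   [b = false]. *)
rewrite /L /qpow; case: b d0 => d0; [left|right] => u.
  have : (expeR ((ln q)%:E * ((- 2%R)%:E *
      deficit u.2 [set l | before (val l) (val u.1)] eta)) <= 1)%E.
    have m2 : ((- 2%R)%:E <= 0 :> \bar R)%E by rewrite lee_fin; lra.
    rewrite -expeR0 lee_expeR; apply: mule_ge0_le0; rewrite ?lee_fin//.
    exact: (mule_le0_ge0 m2 (d0 u)).
  by move=> h; rewrite ge0_fin_numE ?expeR_ge0// (le_lt_trans h)// ltry.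
rewrite -expeR0 lee_expeR; apply: mule_ge0; rewrite ?lee_fin//.
by apply: mule_ge0 => //; rewrite lee_fin.
Unshelve. all: by end_near. Qed.

End DualLimit.

(** * Self-duality *)

Section SelfDuality.
Context {R : realType} (n : nat) (Lam : pred int) (w q : R) (b : bool).
Hypotheses (hw : 0 < w) (hq : 1 <= q).
Implicit Types (x y : particles n Lam) (eta : config n Lam).

Local Notation G := (window_duality q b).

Lemma window_duality_stable N M y eta : within M y ->
  hat ord_max eta (sensitive_end b M.+1) = ord_max ->
  G N M.+1 (occupation y) eta = G N M (occupation y) eta.
Proof.
move=> yM eM; have se : absz (sensitive_end b M.+1) = M.+1.
  by rewrite /sensitive_end; case: b; lia.
rewrite /window_duality window_pairsS eM !(hat_occupation_within yM); [|lia|lia].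
rewrite window_dual_full window_dual_rcons0.
by rewrite /particle_count -cats1 /= count_cat /= !addn0.
Qed.

(** The added site at the sensitive end changes nothing if it is full; otherwise the crude bound on
    the larger window is charged. *)
Lemma window_duality_increment N M y eta : within M y ->
  G N M.+1 (occupation y) eta <= G N M (occupation y) eta +
  window_bound q N M.+1 * (hat ord_max eta (sensitive_end b M.+1) != ord_max)%:R.
Proof.
move=> yM; case: eqP => [e|_]; first by rewrite mulr0 addr0 window_duality_stable.
have /andP[G0 _] := window_duality_bounds b hq N M (occupation y) eta.
have /andP[_ G1] := window_duality_bounds b hq N M.+1 (occupation y) eta.
by rewrite mulr1; apply: le_trans G1 _; rewrite lerDr.
Qed.

Lemma window_duality_monotone N M y eta : b = false -> within M y ->
  G N M (occupation y) eta <= G N M.+1 (occupation y) eta.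
Proof.
move=> bF yM; have se : absz (sensitive_end b M.+1) = M.+1.
  by rewrite /sensitive_end; case: b; lia.
rewrite /window_duality window_pairsS !(hat_occupation_within yM); [|lia|lia].
rewrite -rcons_cons window_dual_rcons0 /particle_count -cats1 /= count_cat /= !addn0 add0n.
rewrite ler_wpM2r// mul1r ler_peMl//.
  by rewrite window_dual_ge0// directed_rate_gt0.
elim: window_pairs => [|p s IH]; first by rewrite big_nil.
rewrite big_cons; apply: mulr_ege1 => //; rewrite /hole_factor.
by case: ifP => // _; rewrite /directed_rate bF invrK exprn_ege1.
Qed.

(** Past radius [r] every added site on the counted side is full, so the limit of the window
    functions is already attained. *)
Lemma duality_function_window (r : nat) y eta j :
  (forall z, r%:Z < (if b then - z else z) -> hat ord_max eta z = ord_max) ->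
  within (r + j).+1 y ->
  duality_function q b y eta = (G (size (val y)) (r + j).+1 (occupation y) eta)%:E.
Proof.
move=> full yw; rewrite -(cvg_lim _ (@window_dual_cvg R n Lam q b hq y eta))//.
apply: cvg_lim => //; apply: cvg_near_cst; near=> M.
have : ((r + j).+1 <= M)%N by near: M; exact: nbhs_infty_ge.
move/subnK => <-; elim: (M - _)%N => // k IH.
rewrite addSn -[RHS]IH; congr _%:E; apply: window_duality_stable.
  by apply: within_le yw; rewrite leq_addl.
by apply: full; rewrite /sensitive_end; case: b; lia.
Unshelve. all: by end_near. Qed.

Lemma duality_function_ge0 x eta : (0 <= duality_function q b x eta)%E.
Proof.
rewrite /duality_function; elim: (val x) => [|u s IH]; first by rewrite big_nil lee01.
rewrite big_cons mule_ge0// mule_ge0 ?expeR_ge0// lee_fin /m.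
by case: (_ <= _)%N.
Qed.

Context (d : measure_display) (Omega : measurableType d).
Variables (P : config n Lam -> probability Omega R).
Variables (X : R -> Omega -> config n Lam).
Hypothesis HA : is_priority_asep P X w q.
Local Notation E := (semigroup P X).
Let HM : is_markov P X. Proof. by case: HA. Qed.

Section FixedInitialData.
Variables (x : particles n Lam) (eta : config n Lam) (t : R) (r : nat).
Hypothesis t0 : 0 <= t.
Hypothesis hx : within r x.
Hypothesis heta : forall z, r%:Z < (if b then - z else z) -> hat ord_max eta z = ord_max.

Local Notation win j := (r + j).+1.
Local Notation N := (size (val x)).
Local Notation g j := (fun omega => (G N (win j) (occupation x) (X t omega))%:E).

Lemma within_window j : within (win j) x.
Proof. by apply: within_le hx; lia. Qed.

Lemma window_state_measurable j : measurable_fun setT (g j : Omega -> \bar R).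
Proof.
apply/measurable_EFinP.
have [_ d2] := window_duality_depends n Lam q b N (win j).
exact: (state_measurable_fun HM t0 (d2 (occupation x))).
Qed.

Lemma window_state_cvg omega : g j omega @[j --> \oo] --> duality_function q b x (X t omega).
Proof.
have := @window_dual_cvg R n Lam q b hq x (X t omega).
rewrite -(cvg_shiftn r.+1).
by apply: cvg_trans; apply: near_eq_cvg; near=> j; rewrite /= addnS addnC.
Unshelve. all: by end_near. Qed.

Lemma window_state_integral j :
  (\int[P eta]_(omega in setT) g j omega = (E t (G N (win j) (occupation x)) eta)%:E)%E.
Proof.
have [_ d2] := window_duality_depends n Lam q b N (win j).
have i := state_integrable HM eta t0 (d2 (occupation x)).
by rewrite /semigroup /Rintegral fineK//; exact: (integrable_fin_num measurableT i).
Qed.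

Lemma duality_function_measurable :
  measurable_fun setT (fun omega => duality_function q b x (X t omega)).
Proof.
apply: (emeasurable_fun_cvg (fun j => g j)); first exact: window_state_measurable.
by move=> omega _; exact: window_state_cvg.
Qed.

(** Each enlargement costs at most the window bound times the probability of a defect at the new
    site, that is, a term of a convergent exponential series. This provides the integrability of
    [D_minus]. *)
Lemma expect_window_bounded : exists C, forall j,
  E t (G N (win j) (occupation x)) eta <= C.
Proof.
pose K := 2 * w * q * t * (q ^+ 2) ^+ (2 * N).
have q0 : 0 < q by apply: lt_le_trans hq.
pose c := (q ^+ 2) ^+ ((r.*2 + 3) * N).
have c0 : 0 <= c by rewrite exprn_ge0// exprn_ge0// ltW.
have K0 : 0 <= K by rewrite !mulr_ge0 ?exprn_ge0// ?ltW.
have step j : E t (G N (win j) (occupation x)) eta <=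
    E t (G N (win 0) (occupation x)) eta + c * series (exp_coeff K) j.+1.
  elim: j => [|j IH].
    by rewrite lerDl mulr_ge0// seriesEnat /= big_nat1 exp_coeff_ge0.
  have [_ d1] := window_duality_depends n Lam q b N (win j).
  have [_ d2] := window_duality_depends n Lam q b N (win j.+1).
  have d1' : depends_on (win j.+1) (G N (win j) (occupation x)).
    by apply: depends_onS (d1 (occupation x)); lia.
  set z := sensitive_end b (win j.+1).
  have zM : (absz z <= win j.+1)%N by rewrite /z /sensitive_end; case: b; lia.
  have d3 : depends_on (win j.+1) (fun eta => (hat ord_max eta z != ord_max)%:R : R).
    exact: (depends_on_hat1 ord_max (fun a => (a != ord_max)%:R) zM).
  have d4 : depends_on (win j.+1) (fun eta : config n Lam =>
      window_bound q N (win j.+1) * (hat ord_max eta z != ord_max)%:R).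
    by move=> a e ae; rewrite (d3 _ _ ae).
  apply: (@le_trans _ _ (E t (G N (win j) (occupation x)) eta +
      window_bound q N (win j.+1) * tail_bound w q t j.+1)).
    apply: (@le_trans _ _ (E t (fun eta => G N (win j) (occupation x) eta +
      window_bound q N (win j.+1) * (hat ord_max eta z != ord_max)%:R) eta)).
      apply: (le_expect HM _ t0 (d2 (occupation x))).
        by move=> a e ae; rewrite (d1' _ _ ae) (d4 _ _ ae).
      by move=> eta'; rewrite /z addnS; apply: window_duality_increment; exact: within_window.
    rewrite (expectD HM _ t0 d1' d4) lerD2l (expectZ HM _ _ t0 d3).
    rewrite ler_wpM2l//; first by rewrite /window_bound exprn_ge0// exprn_ge0// ltW.
    apply: (defect_tail hw hq HA t0 hx heta) => //.
    by rewrite /z /sensitive_end; case: b; lia.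
  rewrite window_tailE -/K -/c seriesEnat /= big_nat_recr//= mulrDr addrA lerD2r.
  by move: IH; rewrite seriesEnat.
exists (E t (G N (win 0) (occupation x)) eta + c * limn (series (exp_coeff K))) => j.
apply: le_trans (step j) _; rewrite lerD2l ler_wpM2l//.
apply: nondecreasing_cvgn_le; last exact: is_cvg_series_exp_coeff.
by apply: nondecreasing_series => i _ _; exact: exp_coeff_ge0.
Qed.

(** For [b = true] the window functions are at most 1 and dominated convergence applies. For
    [b = false] they increase with the window: monotone convergence gives the limit, and
    [expect_window_bounded] its finiteness. *)
Lemma duality_function_integrable_cvg :
  (P eta).-integrable setT (fun omega => duality_function q b x (X t omega)) /\
  (E t (G N (win j) (occupation x)) eta)%:E @[j --> \oo] -->
    (\int[P eta]_(omega in setT) duality_function q b x (X t omega))%E.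
Proof.
have gE : (fun j => \int[P eta]_(omega in setT) g j omega)%E =
    (fun j => (E t (G N (win j) (occupation x)) eta)%:E).
  by apply/funext => j; exact: window_state_integral.
have G0 j omega : 0 <= G N (win j) (occupation x) (X t omega).
  by have /andP[] := window_duality_bounds b hq N (win j) (occupation x) (X t omega).
rewrite -gE; have [bE|bE] : b = true \/ b = false by case: (b); [left|right].
  have gE1 j omega : (`|g j omega| <= 1)%E.
    rewrite gee0_abs ?lee_fin//.
    have Q1 : (directed_rate q b)^-1 <= 1.
      by rewrite /directed_rate bE invf_le1// (lt_le_trans _ hq).
    rewrite /window_duality; case: (_ == _); rewrite ?mulr0 ?mulr1//.
    apply: le_trans (window_dual_le _ _ (lexx 1) Q1) _; last by rewrite !expr1n.
    exact: directed_rate_gt0.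
  have [|||i _ cv] := @dominated_convergence _ _ _ (P eta) setT measurableT
    (fun j => g j) (fun omega => duality_function q b x (X t omega)) (cst 1%E)
    window_state_measurable duality_function_measurable.
  - by apply: nearW => omega _; exact: window_state_cvg.
  - apply: (state_integrable HM eta t0 (@depends_on_cst _ _ _ 0%N 1)).
  - by apply: nearW => omega j _; exact: gE1.
  - by split.
  have gnd omega : nondecreasing_seq (fun j => g j omega).
    apply/nondecreasing_seqP => j; rewrite lee_fin addnS.
    by apply: window_duality_monotone => //; exact: within_window.
  have lim omega : limn (fun j => g j omega) = duality_function q b x (X t omega).
    by apply: cvg_lim => //; exact: window_state_cvg.
  have cv : (\int[P eta]_(omega in setT) g j omega)%E @[j --> \oo] -->
      (\int[P eta]_(omega in setT) duality_function q b x (X t omega))%E.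
    under [X in _ --> X]eq_integral do rewrite -lim.
    apply: cvg_monotone_convergence => //.
      by move=> j; exact: window_state_measurable.
    by move=> j omega _; rewrite lee_fin.
  split=> //; apply/integrableP; split; first exact: duality_function_measurable.
  under eq_integral do rewrite gee0_abs ?duality_function_ge0//.
  rewrite -(cvg_lim _ cv)//; have [C hC] := expect_window_bounded.
  apply: (@le_lt_trans _ _ C%:E); last exact: ltry.
  apply: lime_le; first by apply: cvgP cv.
  by apply: nearW => j; rewrite window_state_integral lee_fin.
Qed.

End FixedInitialData.

(** With a radius enclosing the particles of [x] and the defects of [eta] on the counted side, the
    primal window expectations converge to the left-hand side, and [dual_sum] identifies the same
    limit with the sum over particle lists. *)
Theorem asep_self_dual (S : set (config n Lam)) :
  (forall eta, S eta -> exists r : nat, forall z, r%:Z < (if b then - z else z) ->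
     hat ord_max eta z = ord_max) ->
  self_dual P X (duality_function q b) S.
Proof.
move=> Sfull x eta t /Sfull[r1 h1] t0; have [r2 h2] := within_ex x.
pose r := maxn r1 r2.
have hx : within r x by apply: within_le h2; exact: leq_maxr.
have heta z : r%:Z < (if b then - z else z) -> hat ord_max eta z = ord_max.
  by move=> h; apply: h1; lia.
have [i c] := duality_function_integrable_cvg t0 hx heta; split=> //.
have f := integrable_fin_num measurableT i.
rewrite -(fineK f); apply/esym.
apply: (dual_sum hw hq HA t0 hx heta (duality_function_ge0 ^~ eta)).
  by move=> y j yw yN; rewrite (duality_function_window heta yw) yN.
by move: c; rewrite -{1}(fineK f) => /fine_cvgP[].
Qed.

End SelfDuality.

(** The summands are 0 or 1, so infinitely many defects would contain finite sets of every size and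
    push the sum above every natural number. *)
Lemma finitely_many_defects {R : realType} (n : nat) (Lam : pred int)
    (A : set (site Lam)) (eta : config n Lam) :
  (\esum_(k in A) ((1 - (eta k == ord_max)%:R)%R : R)%:E < +oo)%E ->
  exists r : nat, forall k, A k -> (r < absz (val k))%N -> eta k = ord_max.
Proof.
set F := fun k => _; move=> finF; pose B := [set k | A k /\ eta k != ord_max].
have F0 k : (0 <= F k)%E by rewrite /F lee_fin; case: eqP; rewrite ?subrr ?subr0.
have finB : finite_set B.
  apply: contrapT => infB.
  have ge_nat N : (N%:R%:E <= \esum_(k in A) F k)%E.
    have [C CB CN] := infinite_set_fset N infB.
    apply: esum_ge; exists [set` finmap.enum_fset C].
      by split=> [|k /CB[]//]; exact: finite_seq.
    rewrite -fsbig_seq; last exact: finmap.fset_uniq.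
    apply: (@le_trans _ _ (\sum_(k <- finmap.enum_fset C) 1%R%:E)%E).
      by rewrite sumEFin big_const_seq count_predT iter_addr_0 lee_fin ler_nat.
    rewrite big_seq [leRHS]big_seq; apply: lee_sum => k kC.
    by have [_ /negPf ke] := CB k kC; rewrite /F ke subr0.
  have fin : (\esum_(k in A) F k)%E \is a fin_num by rewrite ge0_fin_numE// esum_ge0.
  have := ge_nat (Num.truncn (fine (\esum_(k in A) F k)%E)).+1.
  rewrite -(fineK fin) lee_fin leNgt => /negP; apply.
  by rewrite truncnS_gt.
move: finB => /finite_seqP[s Bs]; exists (\max_(k <- s) absz (val k))%N => k Ak kr.
apply/eqP; apply: contraT => ek.
have ks : k \in s by have : [set` s] k by rewrite -Bs.
move: kr; rewrite ltnNge => /negP; case.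
exact: (@leq_bigmax_seq _ _ predT).
Qed.

Theorem corollary3p7 (R : realType) (n : nat) (w q : R) (Lminus Lplus : int)
    (hn : (1 <= n)%N) (hw : 0 < w) (hq : 1 <= q) :
  ((forall (d : measure_display) (Omega : measurableType d)
       (P : config n (right_half_line Lminus) -> probability Omega R)
       (X : R -> Omega -> config n (right_half_line Lminus)),
     is_priority_asep P X w q -> self_dual P X (D_plus q) setT) /\
   (forall (d : measure_display) (Omega : measurableType d)
       (P : config n (left_half_line Lplus) -> probability Omega R)
       (X : R -> Omega -> config n (left_half_line Lplus)),
     is_priority_asep P X w q -> self_dual P X (D_minus q) setT)) /\
  (forall (d : measure_display) (Omega : measurableType d)
      (P : config n full_line -> probability Omega R)
      (X : R -> Omega -> config n full_line),
    is_priority_asep P X w q ->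
    self_dual P X (D_plus q) (left_full R n) /\
    self_dual P X (D_minus q) (right_full R n)).
Proof.
split; [split|] => d Omega P X HA.
- apply: (asep_self_dual (b := true) hw hq HA) => eta _; exists (absz Lminus) => z h.
  by rewrite hat_out// /right_half_line -ltNge; lia.
- apply: (asep_self_dual (b := false) hw hq HA) => eta _; exists (absz Lplus) => z h.
  by rewrite hat_out// /left_half_line -ltNge; lia.
- split.
    apply: (asep_self_dual (b := true) hw hq HA) => eta.
    move=> /finitely_many_defects[r hr]; exists r => z h.
    pose k : site full_line := exist _ z isT.
    by rewrite -[z]/(val k) hat_val; apply: hr => /=; lia.
  apply: (asep_self_dual (b := false) hw hq HA) => eta.
  move=> /finitely_many_defects[r hr]; exists r => z h.
  pose k : site full_line := exist _ z isT.
  by rewrite -[z]/(val k) hat_val; apply: hr => /=; lia.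
Qed.
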